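(* Every spherical uniform disk graph with radius $r$ on $n$ vertices has tree-independence number $\mathcal{O}(\sqrt{n})$. A tree decomposition witnessing this can be computed in $\mathsf{poly}(n)$ time.
   Context: All graphs are finite and simple; $\alpha$ is the independence number. On the unit sphere $\mathbb{S}^2\subset\mathbb{R}^3$ with spherical distance $d_{\mathbb{S}^2}(a,b)$ (the angle between vectors $a$ and $b$), the spherical disk of radius $r\in(0,\pi)$ centered at $v$ is $\{u\in\mathbb{S}^2: d_{\mathbb{S}^2}(u,v)\le r\}$. A spherical uniform disk graph with radius $r$ is the intersection graph of a finite collection of spherical disks of the same radius $r$ (vertices are the disks, two distinct ones adjacent iff they intersect). The implicit constant is absolute (independent of $r$ and $n$). For the algorithmic part, $G$ is given together with a geometric realization consisting of the polar coordinates of the disk centers (with respect to a pole $o$, its antipode $o^*$ and a polar axis, i.e. a length-$\pi$ geodesic arc from $o$ to $o^*$, a point $p\neq o,o^*$ is given by its spherical distance from $o$ and the angle $\theta(p)\in[0,2\pi)$ from the polar axis to the geodesic segment $op$), and it is assumed that for a disk $O$, computing $\inf_{x\in O}\theta(x)$ and $\sup_{x\in O}\theta(x)$ takes constant time. A tree decomposition of $G$ is a pair $(T,\{X_t\}_{t\in V(T)})$ with $T$ a tree and bags $X_t\subseteq V(G)$ such that every vertex is in some bag, both endpoints of every edge lie in a common bag, and for each $u\in V(G)$ the nodes $t$ with $u\in X_t$ induce a connected subgraph of $T$. Its independence number is $\max_t\alpha(G[X_t])$; the tree-independence number of $G$ is the minimum independence number of a tree decomposition of $G$. *)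

(* Defs.v *)
From HB Require Import structures.
From mathcomp Require Import all_boot all_order all_algebra.
From mathcomp Require Import all_classical all_reals all_analysis.
Set Implicit Arguments.
Unset Strict Implicit.
Unset Printing Implicit Defensive.
Import Order.TTheory GRing.Theory Num.Theory.
Local Open Scope classical_set_scope.
Local Open Scope ring_scope.

Section Graphs.
Variable V : finType.
Implicit Types (G : rel V) (X S : {set V}).

Definition simple_graph G : Prop := symmetric G /\ irreflexive G.

Definition independent G S : bool :=
  [forall u in S, forall v in S, ~~ G u v].

(* [alpha G X] is the independence number of the induced subgraph G[X]. *)
Definition alpha G X : nat :=
  \max_(S : {set V} | (S \subset X) && independent G S) #|S|.

(* [ucycle G s] also holds when s consists of the two ends of an edge, hence
   the bound 2 rather than 0. *)
Definition is_tree G : Prop :=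
  [/\ simple_graph G, (0 < #|V|)%N, (forall x y, connect G x y)
    & (forall s : seq V, ucycle G s -> (size s <= 2)%N)].

End Graphs.

Section TreeDecompositions.
Variables (V : finType) (G : rel V).

Definition tree_decomposition (T : finType) (E : rel T) (bag : T -> {set V}) :
    Prop :=
  [/\ is_tree E,
      (forall u, exists t, u \in bag t),
      (forall u v, G u v -> exists2 t, u \in bag t & v \in bag t)
    & (forall u t1 t2, u \in bag t1 -> u \in bag t2 ->
        connect [rel x y | [&& E x y, u \in bag x & u \in bag y]] t1 t2)].

Definition decomposition_alpha (T : finType) (bag : T -> {set V}) : nat :=
  \max_(t : T) alpha G (bag t).

Definition has_tree_alpha (k : nat) : bool :=
  `[< exists (T : finType) (E : rel T) (bag : T -> {set V}),
        tree_decomposition E bag /\ decomposition_alpha bag = k >].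

Lemma has_tree_alpha_ex : exists k, has_tree_alpha k.
Proof.
exists (decomposition_alpha (fun _ : unit => [set: V]%SET)).
apply/asboolP; exists unit, (fun _ _ => false), (fun _ => [set: V]%SET).
split=> //; split.
- split=> //; first by rewrite card_unit.
  + by move=> [] []; exact: connect0.
  + by case=> [|x [|y s]] // /andP[].
- by move=> u; exists tt; rewrite inE.
- by move=> u v _; exists tt; rewrite inE.
- by move=> u [] [] _ _; exact: connect0.
Qed.

Definition tree_independence_number : nat := ex_minn has_tree_alpha_ex.

End TreeDecompositions.

Section Sphere.
Variable R : realType.
Implicit Types (u v p : 'rV[R]_3) (r : R).

Definition dot u v : R := \sum_(i < 3) u ord0 i * v ord0 i.

Definition sphere : set 'rV[R]_3 := [set u | dot u u = 1].

Definition sdist u v : R := acos (dot u v).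

Definition sdisk r v : set 'rV[R]_3 := [set u | sphere u /\ sdist u v <= r].

(* The disks form an indexed family: repetitions are allowed. *)
Definition disk_realization (V : finType) r (c : V -> 'rV[R]_3) (G : rel V) :
    Prop :=
  (forall x : V, sphere (c x)) /\
  (forall x y : V,
     G x y <-> x <> y /\ sdisk r (c x) `&` sdisk r (c y) !=set0).

Definition spherical_uniform_disk_graph (V : finType) r (G : rel V) : Prop :=
  exists c : V -> 'rV[R]_3, disk_realization r c G.

(* A polar coordinate system is an orthonormal triple: the pole [po], the
   direction [pa] in which the polar axis leaves the pole (so the axis is
   {cos t po + sin t pa | 0 <= t <= pi}), and the direction [pb] fixing the
   sense in which angles increase. *)
Record polar_system := PolarSystem {
  po : 'rV[R]_3;
  pa : 'rV[R]_3;
  pb : 'rV[R]_3;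
  _ : [/\ sphere po, sphere pa & sphere pb];
  _ : [/\ dot po pa = 0, dot po pb = 0 & dot pa pb = 0]
}.

(* At the two poles every angle in [0, 2pi[ is accepted. *)
Definition polar_coordinates (F : polar_system) p (phi theta : R) : Prop :=
  [/\ phi = sdist (po F) p, 0 <= theta < 2 * pi
    & p = cos phi *: po F +
          sin phi *: (cos theta *: pa F + sin theta *: pb F)].

Definition angles (F : polar_system) (O : set 'rV[R]_3) : set R :=
  [set theta | exists p, [/\ O p, p <> po F, p <> - po F
                           & exists phi, polar_coordinates F p phi theta]].

End Sphere.

(* Real RAM in structured form.  A program manipulates finitely many
   two-dimensional arrays of naturals and of reals, addressed by computed
   naturals.  All expressions of a program have fixed size, so every evaluation
   counts for one time unit.  Multiplication of naturals, integer parts and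
   real constants other than 0, 1 and pi are deliberately absent: on naturals, with
   unit-cost addition and subtraction only, running times agree up to a
   polynomial with those of Turing machines. *)

Inductive nexp :=
  | NConst (k : nat)
  | NSize
  | NGet (a : nat) (i j : nexp)
  | NAdd (e1 e2 : nexp)
  | NSub (e1 e2 : nexp).

Inductive rexp :=
  | RZero
  | ROne
  | RPi
  | RGet (a : nat) (i j : nexp)
  | RRadius
  | RPhi (i : nexp)
  | RTheta (i : nexp)
  | RInfTheta (i : nexp)
  | RSupTheta (i : nexp)
  | RAdd (e1 e2 : rexp)
  | RSub (e1 e2 : rexp)
  | RMul (e1 e2 : rexp)
  | RDiv (e1 e2 : rexp).

Inductive bexp :=
  | BAdj (i j : nexp)
  | BNle (e1 e2 : nexp)
  | BRle (e1 e2 : rexp)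
  | BNot (b : bexp)
  | BAnd (b1 b2 : bexp).

Inductive cmd :=
  | Skip
  | NSet (a : nat) (i j e : nexp)
  | RSet (a : nat) (i j : nexp) (e : rexp)
  | Seq (c1 c2 : cmd)
  | If (b : bexp) (c1 c2 : cmd)
  | While (b : bexp) (c : cmd).

Section Machine.
Variable R : realType.

Record state := State {
  nmem : nat -> nat -> nat -> nat;
  rmem : nat -> nat -> nat -> R
}.

Definition initial_state : state := State (fun _ _ _ => 0%N) (fun _ _ _ => 0).

Definition update (A : Type) (m : nat -> nat -> nat -> A) (a i j : nat) (x : A) :
    nat -> nat -> nat -> A :=
  fun a' i' j' => if [&& a' == a, i' == i & j' == j] then x else m a' i' j'.

(* [in_inf i] and [in_sup i] answer the constant-time queries for the extremal
   angles of the i-th disk. *)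
Record input := Input {
  in_size : nat;
  in_adj : nat -> nat -> bool;
  in_radius : R;
  in_phi : nat -> R;
  in_theta : nat -> R;
  in_inf : nat -> R;
  in_sup : nat -> R
}.

Variable I : input.

Fixpoint neval (s : state) (e : nexp) : nat :=
  match e with
  | NConst k => k
  | NSize => in_size I
  | NGet a i j => nmem s a (neval s i) (neval s j)
  | NAdd e1 e2 => (neval s e1 + neval s e2)%N
  | NSub e1 e2 => (neval s e1 - neval s e2)%N
  end.

Fixpoint reval (s : state) (e : rexp) : R :=
  match e with
  | RZero => 0
  | ROne => 1
  | RPi => pi
  | RGet a i j => rmem s a (neval s i) (neval s j)
  | RRadius => in_radius I
  | RPhi i => in_phi I (neval s i)
  | RTheta i => in_theta I (neval s i)
  | RInfTheta i => in_inf I (neval s i)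
  | RSupTheta i => in_sup I (neval s i)
  | RAdd e1 e2 => reval s e1 + reval s e2
  | RSub e1 e2 => reval s e1 - reval s e2
  | RMul e1 e2 => reval s e1 * reval s e2
  | RDiv e1 e2 => reval s e1 / reval s e2
  end.

Fixpoint beval (s : state) (b : bexp) : bool :=
  match b with
  | BAdj i j => in_adj I (neval s i) (neval s j)
  | BNle e1 e2 => (neval s e1 <= neval s e2)%N
  | BRle e1 e2 => reval s e1 <= reval s e2
  | BNot b1 => ~~ beval s b1
  | BAnd b1 b2 => beval s b1 && beval s b2
  end.

(* [exec c s t s']: started in [s], [c] halts in [s'] after [t] time units. *)
Inductive exec : cmd -> state -> nat -> state -> Prop :=
  | ExecSkip s : exec Skip s 1 s
  | ExecNSet s a i j e :
      exec (NSet a i j e) s 1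
        (State (update (nmem s) a (neval s i) (neval s j) (neval s e)) (rmem s))
  | ExecRSet s a i j e :
      exec (RSet a i j e) s 1
        (State (nmem s) (update (rmem s) a (neval s i) (neval s j) (reval s e)))
  | ExecSeq c1 c2 s1 s2 s3 t1 t2 :
      exec c1 s1 t1 s2 -> exec c2 s2 t2 s3 -> exec (Seq c1 c2) s1 (t1 + t2) s3
  | ExecIfTrue b c1 c2 s s' t :
      beval s b -> exec c1 s t s' -> exec (If b c1 c2) s t.+1 s'
  | ExecIfFalse b c1 c2 s s' t :
      ~~ beval s b -> exec c2 s t s' -> exec (If b c1 c2) s t.+1 s'
  | ExecWhileTrue b c s1 s2 s3 t1 t2 :
      beval s1 b -> exec c s1 t1 s2 -> exec (While b c) s2 t2 s3 ->
      exec (While b c) s1 (t1 + t2).+1 s3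
  | ExecWhileFalse b c s :
      ~~ beval s b -> exec (While b c) s 1 s.

(* The output tree has vertex set 'I_m with m in cell (0, 0) of array 0; array 1
   holds its adjacency matrix and array 2 the incidence matrix of the bags. *)
Definition out_size (s : state) : nat := nmem s 0 0 0.

Definition out_edge (s : state) : rel 'I_(out_size s) :=
  fun i j => nmem s 1 i j != 0%N.

Definition out_bag (n : nat) (s : state) (t : 'I_(out_size s)) : {set 'I_n} :=
  [set v : 'I_n | nmem s 2 t v != 0%N]%SET.

End Machine.

Section InputEncoding.
Variables (R : realType) (n : nat).

Definition extend (A : Type) (x0 : A) (f : 'I_n -> A) (i : nat) : A :=
  oapp f x0 (insub i).

Definition realization_input (G : rel 'I_n) (r : R) (F : polar_system R)
    (c : 'I_n -> 'rV[R]_3) (phi theta : 'I_n -> R) : input R :=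
  {| in_size := n;
     in_adj := fun i j => extend false (fun u => extend false (G u) j) i;
     in_radius := r;
     in_phi := extend 0 phi;
     in_theta := extend 0 theta;
     in_inf := extend 0 (fun u => inf (angles F (sdisk r (c u))));
     in_sup := extend 0 (fun u => sup (angles F (sdisk r (c u)))) |}.

End InputEncoding.

(* Main.v *)
(* The vertices are split greedily into layers along the polar distance phi: a
   layer starts at the least phi not yet covered and has phi-width 2r, so that
   edges join only equal or consecutive layers.  A layer is light if it has at
   most sqrt n vertices; there are at most sqrt n heavy layers.  Sort the
   vertices by (number of light layers below, light before heavy, theta) and take
   the path decomposition of this vertex order, where a vertex stays in the bags
   from its own position to that of its last neighbour.  A bag then meets at most
   two light layers, and a vertex x of a heavy layer in the bag of w has a
   neighbour y with theta x <= theta w <= theta y.  The segment from x to y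
   crosses the half plane of angle theta w or of angle 0, so x is near one of two
   meridians; a packing argument bounds the independent sets of such vertices in
   one layer by a constant.  Hence every bag has independence number O(sqrt n).
   The order is computed from phi, theta and r alone, by nested loops. *)

Require Import Defs.
From HB Require Import structures.
From mathcomp Require Import all_boot all_order all_algebra.
From mathcomp Require Import all_classical all_reals all_analysis.
From mathcomp Require Import ring lra zify.
Set Implicit Arguments.
Unset Strict Implicit.
Unset Printing Implicit Defensive.
Import Order.TTheory GRing.Theory Num.Theory.
Local Open Scope ring_scope.

(** * Plane geometry of polar angles *)

Section Chords.
Variable R : realType.
Implicit Types (a b d h rho s t x y omega : R).

(* Squared Euclidean distance between the points of the unit sphere with polar
   coordinates (a, s) and (b, t). *)
Definition chord2 a s b t : R :=
  (cos a - cos b) ^+ 2 + (sin a * cos s - sin b * cos t) ^+ 2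
  + (sin a * sin s - sin b * sin t) ^+ 2.

Lemma chord2E a s b t :
  chord2 a s b t =
  2 - 2 * (cos a * cos b + sin a * sin b * (cos s * cos t + sin s * sin t)).
Proof.
rewrite /chord2; have := cos2Dsin2 a; have := cos2Dsin2 b.
have := cos2Dsin2 s; have := cos2Dsin2 t.
move: (cos a) (cos b) (cos s) (cos t) (sin a) (sin b) (sin s) (sin t).
move=> ca cb cs ct sa sb ss st ht hs hb ha.
transitivity ((ca ^+ 2 + sa ^+ 2 * (cs ^+ 2 + ss ^+ 2)) +
              (cb ^+ 2 + sb ^+ 2 * (ct ^+ 2 + st ^+ 2)) -
              2 * (ca * cb + sa * sb * (cs * ct + ss * st))).
  by ring.
by rewrite hs ht !mulr1 ha hb.
Qed.

Lemma ler_cos x y : 0 <= x <= pi -> 0 <= y <= pi ->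
  (cos x <= cos y) = (y <= x).
Proof. by move=> hx hy; rewrite !leNgt ltr_cos ?in_itv. Qed.

(** With [e] = |d|/2, the left side is 4(1 - cos e)(1 + cos e), where the last factor is at most 2
    and cos e is at least cos r. *)
Lemma chord_double r d : 0 <= r <= pi -> `|d| <= 2 * r ->
  2 - 2 * cos d <= 4 * (2 - 2 * cos r).
Proof.
move=> /andP[r0 rp] dr; rewrite -(cos_norm d).
have -> : `|d| = (`|d| / 2) *+ 2 by rewrite -mulr_natr divfK ?pnatr_eq0.
rewrite cos_mulr2n; set e := `|d| / 2.
have ce : cos r <= cos e.
  have e0 : 0 <= e by rewrite divr_ge0.
  have er : e <= r by rewrite /e ler_pdivrMr // mulrC.
  by rewrite ler_cos ?r0 ?e0 ?(le_trans er).
have := cos_le1 e; have := cos_geN1 e; move: (cos e) (cos r) ce => x y.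
by rewrite mulr2n => *; nra.
Qed.

(* The segment joining two points of the plane with polar angles omega - a and
   omega + b meets the ray of angle omega. *)
Lemma segment_meets_ray omega a b rho rho' :
  0 <= a -> 0 <= b -> a + b <= pi -> 0 <= rho -> 0 <= rho' ->
  exists t s, [/\ 0 <= t <= 1, 0 <= s,
    (1 - t) * (rho * cos (omega - a)) + t * (rho' * cos (omega + b)) =
      s * cos omega &
    (1 - t) * (rho * sin (omega - a)) + t * (rho' * sin (omega + b)) =
      s * sin omega].
Proof.
move=> a0 b0 abp h h'.
have sa : 0 <= sin a by apply: sin_ge0_pi; rewrite a0 /=; lra.
have sb : 0 <= sin b by apply: sin_ge0_pi; rewrite b0 /=; lra.
have sab : 0 <= sin (a + b) by apply: sin_ge0_pi; rewrite abp addr_ge0.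
(* In the degenerate case both points lie on the line of the ray, and one end of the segment serves
   as the crossing point. *)
case: (eqVneq (rho' * sin b + rho * sin a) 0) => [D0|D0].
- have /andP[/eqP B0 /eqP A0] :
      (rho' * sin b == 0) && (rho * sin a == 0).
    by rewrite -paddr_eq0 ?mulr_ge0 // D0.
  case: (eqVneq rho 0) => [->|r0].
    by exists 0, 0; split; rewrite ?lexx ?ler01 //; ring.
  case: (eqVneq rho' 0) => [->|r'0].
    by exists 1, 0; split; rewrite ?lexx ?ler01 //; ring.
  case: (eqVneq a 0) => [->|an0].
    by exists 0, rho; split; rewrite ?lexx ?ler01 // !subr0; ring.
  case: (eqVneq b 0) => [->|bn0].
    by exists 1, rho'; split; rewrite ?lexx ?ler01 // addr0; ring.
  have : 0 < sin a.
    apply: sin_gt0_pi; rewrite lt_neqAle eq_sym an0 a0 /=.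
    have : 0 < b by rewrite lt_neqAle eq_sym bn0.
    lra.
  by move/eqP: A0; rewrite mulf_eq0 (negbTE r0) /= => /eqP ->; rewrite ltxx.
(* The signed distances of the two ends from the line of the ray are - rho sin a and rho' sin b.
   Their gap is [D], so the crossing occurs at the fraction rho sin a / D. *)
set D := _ + _ in D0.
have Dp : 0 < D by rewrite lt_neqAle eq_sym D0 addr_ge0 // mulr_ge0.
exists (rho * sin a / D), (rho * rho' * sin (a + b) / D).
have e1 : 1 - rho * sin a / D = rho' * sin b / D.
  by rewrite -{1}(divff D0) -mulrBl /D addrK.
split.
- rewrite divr_ge0 ?mulr_ge0 ?(ltW Dp) //= ler_pdivrMr // mul1r /D lerDr.
  by rewrite mulr_ge0.
- by rewrite divr_ge0 ?mulr_ge0 ?(ltW Dp).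
- by rewrite e1 cosB cosD sinD; field.
- by rewrite e1 sinB sinD; rewrite sinD; field.
Qed.

(** Here x is the cosine of the angle between two rays. Replacing the point at radius s on one ray
    by the point at radius rho at most doubles its distance to the point at radius rho on the other:
    the shift |rho - s| is itself bounded by the original distance. *)
Lemma ray_dist2_scale rho s x : 0 <= rho -> 0 <= s -> -1 <= x <= 1 ->
  rho ^+ 2 * (2 - 2 * x) <= 4 * (rho ^+ 2 - 2 * rho * s * x + s ^+ 2).
Proof.
move=> r0 s0 /andP[x1 x2].
have rs : 0 <= rho * s by rewrite mulr_ge0.
have r2 : 0 <= rho ^+ 2 by rewrite sqr_ge0.
have s2 : 0 <= s ^+ 2 by rewrite sqr_ge0.
case: (leP 0 x) => [x0|x0].
  have h1 : 0 <= (s - rho * x) ^+ 2 by rewrite sqr_ge0.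
  have h2 : 0 <= rho ^+ 2 * ((1 - x) * (1 + 2 * x)).
    by rewrite mulr_ge0 // mulr_ge0 //; lra.
  rewrite -subr_ge0.
  have -> : 4 * (rho ^+ 2 - 2 * rho * s * x + s ^+ 2) - rho ^+ 2 * (2 - 2 * x)
    = 4 * (s - rho * x) ^+ 2 + 2 * (rho ^+ 2 * ((1 - x) * (1 + 2 * x))).
    by ring.
  by rewrite addr_ge0 // mulr_ge0.
have h1 : 0 <= rho * s * - x by rewrite mulr_ge0 //; lra.
have h2 : 0 <= rho ^+ 2 * (1 + x) by rewrite mulr_ge0 //; lra.
nra.
Qed.

(** Projected along the polar axis, the chord crosses the ray of angle omega, at a distance at most
    sqrt D from its first end. [ray_dist2_scale] then moves the crossing point to radius sin a,
    which costs the factor 4. *)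
Lemma near_ray a s b t omega D x y :
  0 <= sin a -> 0 <= sin b -> chord2 a s b t <= D ->
  0 <= x -> 0 <= y -> x + y <= pi ->
  cos s = cos (omega - x) -> sin s = sin (omega - x) ->
  cos t = cos (omega + y) -> sin t = sin (omega + y) ->
  chord2 a s a omega <= 4 * D.
Proof.
move=> sa sb cD x0 y0 xy cs ss ct st.
have [tau [w [/andP[t0 t1] w0]]] := segment_meets_ray omega x0 y0 xy sa sb.
rewrite -cs -ss -ct -st => E1 E2.
have := @ray_dist2_scale (sin a) w (cos (s - omega)) sa w0.
rewrite cos_geN1 cos_le1 => /(_ isT).
have -> : chord2 a s a omega = sin a ^+ 2 * (2 - 2 * cos (s - omega)).
  by rewrite chord2E cosB -expr2 cos2sin2; ring.
move/le_trans; apply; rewrite ler_pM2l //; apply: le_trans cD.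
have -> : sin a ^+ 2 - 2 * sin a * w * cos (s - omega) + w ^+ 2 =
          (sin a * cos s - w * cos omega) ^+ 2
          + (sin a * sin s - w * sin omega) ^+ 2.
  rewrite cosB.
  transitivity (sin a ^+ 2 * (cos s ^+ 2 + sin s ^+ 2)
    - 2 * sin a * w * (cos s * cos omega + sin s * sin omega)
    + w ^+ 2 * (cos omega ^+ 2 + sin omega ^+ 2)); last by ring.
  by rewrite !cos2Dsin2 !mulr1.
rewrite -E1 -E2.
(* The part of the projected chord up to the crossing is the fraction [tau] of it, and projecting
   only shortens the chord. *)
apply: (@le_trans _ _ (tau ^+ 2 * chord2 a s b t)).
  rewrite /chord2 -subr_ge0.
  set p := (sin a * cos s - sin b * cos t).
  set q := (sin a * sin s - sin b * sin t).
  have -> : sin a * cos s - ((1 - tau) * (sin a * cos s) + tau * (sin b * cos t))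
    = tau * p by rewrite /p; ring.
  have -> : sin a * sin s - ((1 - tau) * (sin a * sin s) + tau * (sin b * sin t))
    = tau * q by rewrite /q; ring.
  have -> : tau ^+ 2 * ((cos a - cos b) ^+ 2 + p ^+ 2 + q ^+ 2) -
    ((tau * p) ^+ 2 + (tau * q) ^+ 2) = (tau * (cos a - cos b)) ^+ 2 by ring.
  exact: sqr_ge0.
rewrite ler_piMl //.
  by rewrite /chord2 !addr_ge0 // sqr_ge0.
by rewrite expr2 mulr_ile1.
Qed.

Lemma near_meridian a s b t omega D :
  0 <= sin a -> 0 <= sin b -> chord2 a s b t <= D ->
  0 <= s -> s <= omega -> omega <= t -> t <= 2 * pi ->
  chord2 a s a omega <= 4 * D \/ chord2 a s a 0 <= 4 * D.
Proof.
move=> sa sb cD s0 so ot tp; case: (leP (t - s) pi) => ts.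
  left; apply: (@near_ray a s b t omega D (omega - s) (t - omega)) => //;
    rewrite ?subr_ge0 //; try lra.
  1-4: by congr (_ _); ring.
(* The short way from t to s crosses the angle 0; reflect it. *)
right.
have cosE x : cos (- x) = cos (0 + x) by rewrite add0r cosN.
have -> : chord2 a s a 0 = chord2 a (- s) a 0.
  by rewrite /chord2 cosN !sinN sin0; ring.
have cD' : chord2 a (- s) b (- t) <= D.
  by move: cD; rewrite /chord2 !cosN !sinN; apply: le_trans; rewrite le_eqVlt;
     apply/orP; left; apply/eqP; ring.
apply: (@near_ray a (- s) b (- t) 0 D s (2 * pi - t)) => //; try lra.
- by rewrite sub0r.
- by rewrite sub0r.
- by rewrite -(cosD2pi (- t)); congr cos; ring.
- by rewrite -(sinD2pi (- t)); congr sin; ring.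
Qed.

(* Cells of side delta/2 have diameter less than delta. *)
Lemma packing (V : finType) (S : {set V}) (X Y Z : V -> R) x y z delta :
  0 < delta ->
  {in S, forall v, (X v - x) ^+ 2 + (Y v - y) ^+ 2 + (Z v - z) ^+ 2 <=
                     49 * delta ^+ 2} ->
  {in S &, forall u v, u != v ->
     delta ^+ 2 < (X u - X v) ^+ 2 + (Y u - Y v) ^+ 2 + (Z u - Z v) ^+ 2} ->
  (#|S| <= 29 ^ 3)%N.
Proof.
move=> d0 near far.
(* Offsets are measured in units of delta/2. They are at most 7 delta in absolute value, so the
   shift by 14 puts them in [0, 28], giving 29 cells per axis. *)
pose w (p c : R) := 2 * (p - c) / delta + 14.
have wb (p c e : R) : 0 <= e -> (p - c) ^+ 2 + e <= 49 * delta ^+ 2 ->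
    0 <= w p c < 29.
  move=> e0 h; rewrite /w.
  have /ler_normlP[h1 h2] : `|p - c| <= 7 * delta.
    rewrite -(@ler_pXn2r _ 2) ?nnegrE ?mulr_ge0 ?(ltW d0) //.
    by rewrite real_normK ?num_real //; nra.
  rewrite -subr_ge0 -ltrBrDr ltr_pdivrMr //; apply/andP; split; last lra.
  by rewrite subr0 -lerBlDr sub0r ler_pdivlMr //; lra.
have wcl (p q c : R) : 0 <= w p c -> 0 <= w q c ->
    Num.truncn (w p c) = Num.truncn (w q c) -> 4 * (p - q) ^+ 2 <= delta ^+ 2.
  move=> /truncn_itv /andP[a1 a2] /truncn_itv /andP[b1 b2] E.
  rewrite E in a1 a2; move: (Num.truncn _) a1 a2 b1 b2 => k a1 a2 b1 b2.
  have : `|w p c - w q c| <= 1.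
    rewrite -natr1 in a2 b2.
    by rewrite ler_norml; apply/andP; split; lra.
  have -> : w p c - w q c = 2 * (p - q) / delta.
    by rewrite /w; field; rewrite gt_eqF.
  rewrite normrM [`|delta^-1|]gtr0_norm ?invr_gt0 // ler_pdivrMr // mul1r.
  move=> h; have : `|2 * (p - q)| ^+ 2 <= delta ^+ 2.
    by rewrite lerXn2r ?nnegrE ?(ltW d0).
  by rewrite real_normK ?num_real //; apply: le_trans; rewrite exprMn; nra.
have sq (p : R) : 0 <= p ^+ 2 by exact: sqr_ge0.
have nx v : v \in S -> 0 <= w (X v) x < 29.
  by move=> /near h; apply: (wb _ _ _ _ (le_trans _ h));
     [|rewrite -addrA; exact: lexx]; rewrite addr_ge0.
have ny v : v \in S -> 0 <= w (Y v) y < 29.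
  move=> /near h; apply: (wb _ _ ((X v - x) ^+ 2 + (Z v - z) ^+ 2)).
    by rewrite addr_ge0.
  by apply: le_trans h; lra.
have nz v : v \in S -> 0 <= w (Z v) z < 29.
  move=> /near h; apply: (wb _ _ ((X v - x) ^+ 2 + (Y v - y) ^+ 2)).
    by rewrite addr_ge0.
  by apply: le_trans h; lra.
pose cell (p c : R) : 'I_29 := inord (Num.truncn (w p c)).
have cellP (p c : R) : 0 <= w p c < 29 -> cell p c = Num.truncn (w p c) :> nat.
  by move=> /andP[w0 w1]; rewrite /cell inordK // truncn_lt_nat.
pose f v := (cell (X v) x, cell (Y v) y, cell (Z v) z).
have finj : {in S &, injective f}.
  move=> u v uS vS [/(congr1 val) + /(congr1 val) + /(congr1 val)].
  rewrite /= !cellP ?nx ?ny ?nz // => ex ey ez.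
  (* Two points of one cell differ by at most delta/2 in each coordinate, hence by at most 3/4
     delta^2 in squared distance. *)
  apply/eqP; apply/negPn/negP => /(far _ _ uS vS).
  have /andP[ux _] := nx _ uS; have /andP[uy _] := ny _ uS.
  have /andP[uz _] := nz _ uS; have /andP[vx _] := nx _ vS.
  have /andP[vy _] := ny _ vS; have /andP[vz _] := nz _ vS.
  have := wcl _ _ _ ux vx ex; have := wcl _ _ _ uy vy ey.
  have := wcl _ _ _ uz vz ez; have := sq delta; lra.
rewrite -(card_in_imset finj); apply: leq_trans (max_card _) _.
by rewrite !card_prod !card_ord.
Qed.

End Chords.

(** * Spherical disks *)

Section SphericalDisks.
Variable R : realType.
Implicit Types (u v w o : 'rV[R]_3) (r : R).

Lemma dotC u v : dot u v = dot v u.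
Proof. by apply: eq_bigr => i _; rewrite mulrC. Qed.

Lemma dotDl u v w : dot (u + v) w = dot u w + dot v w.
Proof. by rewrite -big_split; apply: eq_bigr => i _; rewrite mxE mulrDl. Qed.

Lemma dotZl a u v : dot (a *: u) v = a * dot u v.
Proof. by rewrite big_distrr; apply: eq_bigr => i _; rewrite mxE /= mulrA. Qed.

Lemma dotDr u v w : dot w (u + v) = dot w u + dot w v.
Proof. by rewrite dotC dotDl !(dotC w). Qed.

Lemma dotZr a u v : dot u (a *: v) = a * dot u v.
Proof. by rewrite dotC dotZl dotC. Qed.

Lemma dot_ge0 u : 0 <= dot u u.
Proof. by apply: sumr_ge0 => i _; rewrite -expr2 sqr_ge0. Qed.

Lemma dot_cauchy_schwarz u v : dot u v ^+ 2 <= dot u u * dot v v.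
Proof.
rewrite /dot !big_ord_recr !big_ord0 /= !add0r.
move: (u _ _) (u _ _) (u _ _) (v _ _) (v _ _) (v _ _) => c b a z y x.
rewrite -subr_ge0.
(* Lagrange's identity. *)
have -> : (a * a + b * b + c * c) * (x * x + y * y + z * z) -
    (a * x + b * y + c * z) ^+ 2 =
  (a * y - b * x) ^+ 2 + (a * z - c * x) ^+ 2 + (b * z - c * y) ^+ 2 by ring.
by rewrite !addr_ge0 ?sqr_ge0.
Qed.

Lemma dot_sphere_itv u v : sphere u -> sphere v -> -1 <= dot u v <= 1.
Proof.
rewrite /sphere /= => u1 v1; have := dot_cauchy_schwarz u v.
rewrite u1 v1 mulr1 => h; rewrite -ler_norml -(@ler_pXn2r _ 2) ?nnegrE //.
by rewrite real_normK ?num_real // expr1n.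
Qed.

Lemma cos_sdist u v : sphere u -> sphere v -> cos (sdist u v) = dot u v.
Proof. by move=> u1 v1; rewrite acosK // in_itv dot_sphere_itv. Qed.

Lemma sdist_itv u v : sphere u -> sphere v -> 0 <= sdist u v <= pi.
Proof. by move=> u1 v1; rewrite acos_ge0 ?acos_lepi // dot_sphere_itv. Qed.

Lemma sdist_le u v r : sphere u -> sphere v -> 0 < r < pi ->
  (sdist u v <= r) = (cos r <= dot u v).
Proof.
move=> u1 v1 /andP[r0 rp]; rewrite -cos_sdist // ler_cos ?sdist_itv //.
by rewrite !ltW.
Qed.

(** Cauchy-Schwarz for the components of u and v orthogonal to o, whose lengths are sin a and sin b,
    gives dot u v <= cos (a - b). *)
Lemma sdist_triangle o u v : sphere o -> sphere u -> sphere v ->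
  `|sdist o u - sdist o v| <= sdist u v.
Proof.
move=> o1 u1 v1.
have /andP[a0 ap] := sdist_itv o1 u1; have /andP[b0 bp] := sdist_itv o1 v1.
set a := sdist o u in a0 ap *; set b := sdist o v in b0 bp *.
have ea : dot o u = cos a by rewrite cos_sdist.
have eb : dot o v = cos b by rewrite cos_sdist.
rewrite -ler_cos ?sdist_itv //; last first.
  by rewrite normr_ge0 ler_norml; apply/andP; split; lra.
rewrite cos_norm cosB cos_sdist //.
have := dot_cauchy_schwarz (u + (- cos a) *: o) (v + (- cos b) *: o).
rewrite !(dotDl, dotDr, dotZl, dotZr) (dotC u o) (dotC v o) ea eb.
rewrite !(o1 : dot o o = 1) (u1 : dot u u = 1) (v1 : dot v v = 1).
move=> cs.
have h : (dot u v - cos a * cos b) ^+ 2 <= (sin a * sin b) ^+ 2.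
  by rewrite exprMn !sin2cos2; lra.
rewrite -lerBlDl; apply: le_trans (ler_norm _) _.
have s0 : 0 <= sin a * sin b by rewrite mulr_ge0 // sin_ge0_pi ?a0 ?b0.
by rewrite -(@ler_pXn2r _ 2) ?nnegrE // real_normK ?num_real.
Qed.

Variables (F : polar_system R) (V : finType) (r : R) (c : V -> 'rV[R]_3).
Variables (G : rel V) (phi theta : V -> R).
Hypothesis r_itv : 0 < r < pi.
Hypothesis Gc : disk_realization r c G.
Hypothesis polar : forall x, polar_coordinates F (c x) (phi x) (theta x).

Lemma phi_itv x : 0 <= phi x <= pi.
Proof.
have [-> _ _] := polar x; have o1 : sphere (po F) by case: F => ? ? ? [].
by apply: sdist_itv => //; case: Gc.
Qed.

Lemma theta_itv x : 0 <= theta x < 2 * pi.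
Proof. by have [] := polar x. Qed.

Lemma sin_phi_ge0 x : 0 <= sin (phi x).
Proof. by rewrite sin_ge0_pi ?phi_itv. Qed.

Lemma chord2_dot x y :
  chord2 (phi x) (theta x) (phi y) (theta y) = 2 - 2 * dot (c x) (c y).
Proof.
rewrite chord2E; congr (_ - 2 * _).
have [_ _ ->] := polar x; have [_ _ ->] := polar y.
case: F => p q s [p1 q1 s1] [pq ps qs] /=.
rewrite !(dotDl, dotDr, dotZl, dotZr) (dotC q p) (dotC s p) (dotC s q).
by rewrite (p1 : dot p p = 1) (q1 : dot q q = 1) (s1 : dot s s = 1) pq ps qs; ring.
Qed.

Lemma disk_adjacent x y : G x y ->
  `|phi x - phi y| <= 2 * r /\
  chord2 (phi x) (theta x) (phi y) (theta y) <= 4 * (2 - 2 * cos r).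
Proof.
have [c1 GE] := Gc; move=> /GE[_ [w [[w1 wx] [_ wy]]]].
split.
  have [-> _ _] := polar x; have [-> _ _] := polar y.
  have o1 : sphere (po F) by case: F => ? ? ? [].
  have := sdist_triangle o1 w1 (c1 x); have := sdist_triangle o1 w1 (c1 y).
  by rewrite !ler_norml => /andP[? ?] /andP[? ?]; apply/andP; split; lra.
rewrite chord2_dot; move: wx wy; rewrite !sdist_le //.
(* Nonnegativity of this square amounts to |x - y|^2 <= 2|x - w|^2 + 2|y - w|^2 for the centers and
   a common point [w]. *)
have := dot_ge0 (c x + c y + (- 2) *: w).
rewrite !(dotDl, dotDr, dotZl, dotZr) (dotC (c x) w) (dotC (c y) w).
rewrite (dotC (c y) (c x)) !(c1 _ : dot _ _ = 1) (w1 : dot w w = 1); lra.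
Qed.

(** Centers at angle at most r would make the center of x a common point of both disks. Separation
    by the chord of r, rather than of 2r, suffices for the packing. *)
Lemma disk_nonadjacent x y : x != y -> ~~ G x y ->
  2 - 2 * cos r < chord2 (phi x) (theta x) (phi y) (theta y).
Proof.
have [c1 GE] := Gc; move=> xy; rewrite chord2_dot ltNge; apply: contra => h.
apply/GE; split; first exact/eqP.
exists (c x); split; split => //; rewrite sdist_le //.
  by rewrite (c1 _ : dot _ _ = 1) cos_le1.
lra.
Qed.

(** By [near_meridian] every vertex of S is close to the meridian of angle omega or of angle 0. As
    polar distances in S differ by at most 2r, each of the two groups lies in a ball whose radius is
    a constant multiple of the chord of r, and [packing] applies. *)
Lemma layer_slice (S : {set V}) (omega : R) :
  {in S &, forall x y, ~~ G x y} ->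
  {in S &, forall x y, `|phi x - phi y| <= 2 * r} ->
  {in S, forall x, exists2 y, (x == y) || G x y
                            & theta x <= omega <= theta y} ->
  (#|S| <= 2 * 29 ^ 3)%N.
Proof.
move=> ind lay act.
(* The squared chord of an arc of length r: the unit of all squared distances below. *)
set d2 := 2 - 2 * cos r.
have /andP[r0 rp] := r_itv.
have d2p : 0 < d2.
  have : cos r < cos 0 by rewrite ltr_cos ?in_itv /= ?lexx ?pi_ge0 ?(ltW r0) ?(ltW rp).
  by rewrite cos0 /d2; lra.
pose T (t : R) := [set x in S | chord2 (phi x) (theta x) (phi x) t <= 16 * d2]%SET.
have TU : S \subset (T omega :|: T 0)%SET.
  apply/fintype.subsetP => x xS; rewrite !inE xS /=.
  have [y xy /andP[xo oy]] := act x xS; apply/orP.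
  have D : chord2 (phi x) (theta x) (phi y) (theta y) <= 4 * d2.
    case/orP: xy => [/eqP <-|/disk_adjacent[] //].
    rewrite chord2_dot; have [c1 _] := Gc.
    by rewrite (c1 _ : dot _ _ = 1) mulr1 subrr mulr_ge0 // ltW.
  have /andP[x0 _] := theta_itv x; have /andP[_ /ltW y1] := theta_itv y.
  have -> : 16 * d2 = 4 * (4 * d2) by ring.
  exact: near_meridian (sin_phi_ge0 x) (sin_phi_ge0 y) D x0 xo oy y1.
have TK (w : R) : (#|T w| <= 29 ^ 3)%N.
  case: (set_0Vmem (T w)) => [->|[z]]; first by rewrite cards0.
  rewrite inE => /andP[zS _].
  (* The ball is centered at the point of the meridian [w] at the polar distance of an arbitrary
     member [z]. *)
  apply: (@packing R V (T w) (fun x => cos (phi x))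
    (fun x => sin (phi x) * cos (theta x)) (fun x => sin (phi x) * sin (theta x))
    (cos (phi z)) (sin (phi z) * cos w) (sin (phi z) * sin w) (Num.sqrt d2)).
  - by rewrite sqrtr_gt0.
  - move=> x; rewrite inE => /andP[xS near]; rewrite sqr_sqrtr ?(ltW d2p) //.
    have : chord2 (phi x) w (phi z) w <= 4 * d2.
      rewrite chord2E -!expr2 cos2Dsin2 mulr1 -cosB.
      by apply: chord_double; rewrite ?(ltW r0) ?(ltW rp) ?lay.
    move: near; rewrite /chord2 subrr expr0n add0r.
    set a1 := cos (phi x); set a2 := cos (phi z); set b1 := sin _ * cos (theta x).
    set b2 := sin (phi x) * cos w; set b3 := sin (phi z) * cos w.
    set e1 := sin _ * sin (theta x).
    set e2 := sin (phi x) * sin w; set e3 := sin (phi z) * sin w.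
    move=> near far.
    (* From (p + q)^2 <= 2p^2 + 2q^2 the squared distance is at most 2 * 16 d2 + 2 * 4 d2 = 40 d2,
       within the 49 d2 allowed. *)
    have := sqr_ge0 (b1 - b2 - (b2 - b3)); have := sqr_ge0 (e1 - e2 - (e2 - e3)).
    have := sqr_ge0 (a1 - a2); nra.
  - move=> x y; rewrite !inE => /andP[xS _] /andP[yS _] xy.
    by rewrite sqr_sqrtr ?(ltW d2p) //; apply: disk_nonadjacent => //; exact: ind.
apply: leq_trans (subset_leq_card TU) _.
apply: leq_trans (leq_card_setU _ _) _.
by rewrite mul2n -addnn leq_add.
Qed.

End SphericalDisks.

(** * Path decompositions from vertex orders *)

Section PathDecomposition.
Variables (m : nat) (E : rel 'I_m).
Hypothesis E_path : forall i j, E i j = (i.+1 == j) || (j.+1 == i).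

Lemma segment_connect (P : pred 'I_m) (a b : 'I_m) :
  (a <= b)%N -> (forall t : 'I_m, (a <= t <= b)%N -> P t) ->
  connect [rel x y | [&& E x y, P x & P y]] a b.
Proof.
move: {2}(b - a)%N (erefl (b - a)%N) => d; elim: d a => [|d IH] a da ab Pab.
  suff -> : a = b by exact: connect0.
  by apply/val_inj => /=; lia.
have am : (a.+1 < m)%N by have := ltn_ord b; lia.
apply: (@connect_trans _ _ (Ordinal am)).
  by apply: connect1; rewrite /= E_path eqxx !Pab //=; apply/andP; split; lia.
apply: IH => /=; [lia | lia |] => t /andP[at_ tb].
by apply: Pab; rewrite tb andbT; exact: ltnW.
Qed.

Lemma segment_connect_sym (P : pred 'I_m) (a b : 'I_m) :
  (forall t : 'I_m, (minn a b <= t <= maxn a b)%N -> P t) ->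
  connect [rel x y | [&& E x y, P x & P y]] a b.
Proof.
have Es x y : [&& E x y, P x & P y] = [&& E y x, P y & P x].
  by rewrite !E_path orbC; congr andb; rewrite andbC.
case: (leqP a b) => ab Pab; first exact: segment_connect.
rewrite (@sym_connect_sym _ [rel x y | [&& E x y, P x & P y]]) //.
by apply: segment_connect => //; exact: ltnW.
Qed.

Lemma path_is_tree : (0 < m)%N -> is_tree E.
Proof.
move=> m0; split.
- split; first by move=> x y; rewrite !E_path orbC.
  by move=> x; rewrite E_path; apply/negbTE/negP => /orP[] /eqP; lia.
- by rewrite card_ord.
- move=> x y; have := @segment_connect_sym predT x y (fun _ _ => isT).
  by apply: connect_sub => a b /= /andP[ab _]; exact: connect1.
- move=> s /andP[cs us]; rewrite leqNgt; apply/negP => s3.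
  have [x0 xs] : exists x, x \in s.
    by case: s s3 {cs us} => // x s _; exists x; rewrite mem_head.
  (* The two neighbours in the cycle of its largest element coincide. *)
  case: (arg_maxnP (fun i : 'I_m => i : nat) xs) => x {}xs xmax.
  have [i s' es] := rot_to xs.
  have : cycle E (x :: s') by rewrite -es rot_cycle.
  have : uniq (x :: s') by rewrite -es rot_uniq.
  have : (2 < size (x :: s'))%N by rewrite -es size_rot.
  have {}xmax : forall y, y \in x :: s' -> (y <= x)%N.
    by move=> y; rewrite -es mem_rot => /xmax.
  case/lastP: s' {es} xmax => [|s' z] //; case: s' => [|y s'] // xmax _.
  rewrite /= !rcons_path !last_rcons => /and3P[_ ys _] /and3P[xy _ zx].
  have yx := xmax y; have zx' := xmax z.
  have {yx} : (y <= x)%N by apply: yx; rewrite !inE eqxx orbT.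
  have {zx'} : (z <= x)%N by apply: zx'; rewrite !inE mem_rcons !inE eqxx !orbT.
  move: xy zx; rewrite !E_path => /orP[]/eqP xy /orP[]/eqP zx zx' yx; try lia.
  have yz : y = z by apply/val_inj => /=; lia.
  by move: ys; rewrite yz mem_rcons mem_head.
Qed.

Variables (V : finType) (G : rel V) (rank : V -> nat) (bag : 'I_m -> {set V}).
Hypothesis G_sym : symmetric G.
Hypothesis rank_lt : forall v, (rank v < m)%N.
Hypothesis bagE : forall t v, (v \in bag t) =
  (rank v <= t)%N && [exists u, ((v == u) || G v u) && (t <= rank u)%N].

(** The bags containing u form the interval from the rank of u to the largest rank in its closed
    neighbourhood, and an edge lies in the bag of its later end. Ranks may coincide. *)
Lemma path_decomposition : (0 < m)%N -> tree_decomposition G E bag.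
Proof.
move=> m0; split; first exact: path_is_tree.
- move=> u; exists (Ordinal (rank_lt u)); rewrite bagE leqnn.
  by apply/existsP; exists u; rewrite eqxx leqnn.
- have wl u v : G u v -> (rank u <= rank v)%N ->
      exists2 t, u \in bag t & v \in bag t.
    move=> uv le; exists (Ordinal (rank_lt v)); rewrite bagE.
      by rewrite le; apply/existsP; exists v; rewrite uv leqnn orbT.
    by rewrite leqnn; apply/existsP; exists v; rewrite eqxx leqnn.
  move=> u v uv; case/orP: (leq_total (rank u) (rank v)); first exact: wl.
  by rewrite G_sym in uv => /(wl _ _ uv)[t tv tu]; exists t.
- move=> u t1 t2 u1 u2.
  apply: (@segment_connect_sym (fun t => u \in bag t)) => t.
  move: u1 u2; rewrite !bagE => /andP[r1 /existsP[x /andP[ux x1]]].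
  move=> /andP[r2 /existsP[y /andP[uy y2]]] /andP[t_min t_max].
  apply/andP; split; first by lia.
  apply/existsP; case: (leqP t t1) => tt; first by exists x; rewrite ux; lia.
  by exists y; rewrite uy; lia.
Qed.

End PathDecomposition.

(** * Independence number of the bags of the layered vertex order *)

Section LayeredSweep.
Variables (R : realType) (V : finType) (G : rel V) (lay : V -> nat).
Variable theta : V -> R.
Hypothesis G_sym : symmetric G.
Hypothesis theta_itv : forall v, 0 <= theta v < 2 * pi.
Hypothesis lay_adj : forall u v, G u v -> (lay u <= (lay v).+1)%N.

Definition layer l : {set V} := [set v | lay v == l].
(** The square replaces a square root, which the machine cannot compute. *)
Definition light l : bool := (#|layer l| ^ 2 <= #|V|)%N.
Definition nlight l : nat := \sum_(i < l) light i.
Definition key v : nat := (nlight (lay v)).*2 + ~~ light (lay v).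
(** As theta lies in [0, 2 pi[, comparing these reals is comparing the pairs ([key], [theta])
    lexicographically. *)
Definition kappa v : R := 2 * pi * (key v)%:R + theta v.
Definition krank v : nat := #|[set u | kappa u < kappa v]|.
Definition sweep_bag t : {set V} :=
  [set v | (krank v <= t)%N &&
           [exists u, ((v == u) || G v u) && (t <= krank u)%N]].

Lemma nlightS l : nlight l.+1 = (nlight l + light l)%N.
Proof. by rewrite /nlight big_ord_recr. Qed.

Lemma leq_nlight : {homo nlight : l l' / (l <= l')%N}.
Proof.
by apply: homo_leq; [exact: leqnn|exact: leq_trans|] => l; rewrite nlightS leq_addr.
Qed.

Lemma kappa_le u v : kappa u <= kappa v ->
  (key u <= key v)%N /\ (key u = key v -> theta u <= theta v).
Proof.
rewrite /kappa => h; split; last by move=> e; move: h; rewrite e lerD2l.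
have /andP[u0 _] := theta_itv u; have /andP[_ v1] := theta_itv v.
rewrite -ltnS -(@ltr_nat R) -natr1 -(@ltr_pM2l _ (2 * pi)) ?mulr_gt0 ?pi_gt0 //.
lra.
Qed.

Lemma krank_lt v : (krank v < #|V|)%N.
Proof.
rewrite -cardsT; apply: proper_card; apply/properP; split.
  by apply/fintype.subsetP => u; rewrite !inE.
by exists v; rewrite !inE ?ltxx.
Qed.

Lemma krank_homo u v : kappa u < kappa v -> (krank u < krank v)%N.
Proof.
move=> uv; apply: proper_card; apply/properP; split.
  by apply/fintype.subsetP => x; rewrite !inE => /lt_trans; apply.
by exists u; rewrite !inE ?ltxx.
Qed.

(** Among the vertices of rank at most t, one of largest [kappa] is the pivot w. This turns the rank
    conditions of the bag into inequalities between values of [kappa]. *)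
Lemma sweep_bag_pivot t v0 : v0 \in sweep_bag t ->
  exists w, {in sweep_bag t, forall x, exists2 y, (x == y) || G x y &
                                        kappa x <= kappa w <= kappa y}.
Proof.
rewrite inE => /andP[v0t _].
case: (@arg_maxP _ _ _ v0 (fun v => krank v <= t)%N kappa v0t) => w wt wmax.
exists w => x; rewrite inE => /andP[xt /existsP[y /andP[xy ty]]].
exists y => //; have -> /= : kappa x <= kappa w by exact: wmax.
rewrite leNgt; apply/negP => /krank_homo.
by rewrite ltnNge (leq_trans wt).
Qed.

(** The count [nlight] grows right after each light layer, so the light vertices of one level all
    lie in a single layer. *)
Lemma card_light_level g : (#|[set v | light (lay v) & nlight (lay v) == g]| ^ 2
   <= #|V|)%N.
Proof.
set A := [set v | _]%SET; case: (set_0Vmem A) => [->|[z]]; first by rewrite cards0.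
rewrite inE => /andP[zl /eqP zg]; apply: leq_trans (zl); rewrite leq_exp2r //.
apply: subset_leq_card; apply/fintype.subsetP => v; rewrite !inE.
move=> /andP[vl /eqP vg]; case: (ltngtP (lay v) (lay z)) => // lt.
  by have := leq_nlight lt; rewrite nlightS vl; lia.
by have := leq_nlight lt; rewrite nlightS zl; lia.
Qed.

(** The constant of the packing argument; [layer_slice] supplies it for disk graphs. *)
Variable C0 : nat.
Hypothesis slice : forall (S : {set V}) (omega : R) l,
  {in S &, forall x y, ~~ G x y} -> {in S, forall x, lay x = l} ->
  {in S, forall x, exists2 y, (x == y) || G x y & theta x <= omega <= theta y} ->
  (#|S| <= C0)%N.

(** That x precedes w bounds its level above by that of w. That w precedes y, whose layer is at most
    one above that of x, bounds the level of w by one more than that of x. *)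
Lemma light_in_bag x w y : (x == y) || G x y -> kappa x <= kappa w <= kappa y ->
  light (lay x) ->
  nlight (lay x) = nlight (lay w) \/ nlight (lay x) = (nlight (lay w)).-1.
Proof.
move=> xy /andP[/kappa_le[xw _] /kappa_le[wy _]] xl.
have : (nlight (lay y) <= (nlight (lay x)).+1)%N.
  have : (lay y <= (lay x).+1)%N.
    by case/orP: xy => [/eqP ->//|]; rewrite G_sym => /lay_adj.
  by move=> /leq_nlight; rewrite nlightS xl addn1.
move: xw wy; rewrite /key; do 3 case: (light _) => /=; lia.
Qed.

(* A heavy vertex and its later neighbours precede the next light layer. *)
Lemma heavy_in_bag x w y : (x == y) || G x y -> kappa x <= kappa w <= kappa y ->
  ~~ light (lay x) -> theta x <= theta w <= theta y.
Proof.
move=> xy /andP[/kappa_le[xw txw] /kappa_le[wy twy]] xl.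
have ny : (nlight (lay y) <= nlight (lay x))%N.
  have : (lay y <= (lay x).+1)%N.
    by case/orP: xy => [/eqP ->//|]; rewrite G_sym => /lay_adj.
  by move=> /leq_nlight; rewrite nlightS (negbTE xl) addn0.
have exy : key y = key x.
  by move: xw wy; rewrite /key xl; do 2 case: (light _) => /=; lia.
by rewrite txw ?twy //; lia.
Qed.

(** Heavy layers are disjoint and each has more than [q] vertices, so [q] times their number is at
    most |V| = q^2. *)
Lemma card_heavy_layers M :
  (#|[set l : 'I_M | ~~ light l]|)%:R <= Num.sqrt #|V|%:R :> R.
Proof.
set H := [set l | _]%SET; set q := Num.sqrt _.
case: (posnP #|V|) => [V0|Vp].
  suff -> : H = finset.set0 by rewrite cards0 sqrtr_ge0.
  apply/setP => l; rewrite !inE /light V0 leqn0 expn_eq0 cards_eq0 andbT.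
  by apply/negbTE; rewrite negbK -cards_eq0 -leqn0 -V0 max_card.
have qp : 0 < q by rewrite sqrtr_gt0 ltr0n.
rewrite -(ler_pM2r qp) -[leRHS]expr2 sqr_sqrtr ?ler0n //.
apply: (@le_trans _ _ (\sum_(l in H) #|layer l|%:R)).
  rewrite -sum1_card natr_sum mulr_suml; apply: ler_sum => l.
  rewrite inE mul1r -ltnNge => /ltnW hl.
  rewrite -(@ler_pXn2r _ 2) ?nnegrE ?sqrtr_ge0 //.
  by rewrite sqr_sqrtr ?ler0n // -natrX ler_nat.
rewrite -natr_sum ler_nat.
under eq_bigr do rewrite -sum1_card big_mkcond.
rewrite exchange_big -sum1_card; apply: leq_sum => v _ /=.
rewrite -big_mkcondr sum1_card; apply/card_le1_eqP => l l'.
move=> /andP[_ vl] /andP[_ vl'].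
move: (vl : v \in layer l) (vl' : v \in layer l'); rewrite !inE.
by move=> /eqP e /eqP e'; apply/val_inj; rewrite -[RHS]e.
Qed.

Lemma card_heavy_in_bag (S : {set V}) (omega : R) :
  {in S &, forall x y, ~~ G x y} -> {in S, forall x, ~~ light (lay x)} ->
  {in S, forall x, exists2 y, (x == y) || G x y & theta x <= omega <= theta y} ->
  #|S|%:R <= C0%:R * Num.sqrt #|V|%:R :> R.
Proof.
move=> ind heavy act; pose M := (\max_(v : V) lay v).+1.
have layM v : (lay v < M)%N by rewrite ltnS; exact: leq_bigmax.
apply: le_trans (ler_wpM2l (ler0n _ _) (card_heavy_layers M)).
rewrite -natrM ler_nat -sum1_card.
rewrite (partition_big (fun v => Ordinal (layM v))
  (mem [set l : 'I_M | ~~ light l]%SET)) /=; last first.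
  by move=> v vS; rewrite inE heavy.
rewrite mulnC -sum_nat_const; apply: leq_sum => l _.
have -> : (\sum_(v in S | Ordinal (layM v) == l) 1 =
           #|[set v in S | lay v == l]|)%N.
  by rewrite -sum1_card; apply: eq_bigl => v; rewrite !inE.
apply: (@slice _ omega l) => [x y|x|x]; rewrite !inE.
- by move=> /andP[xS _] /andP[yS _]; exact: ind.
- by case/andP => _ /eqP.
- by case/andP => /act.
Qed.

(** Relative to the pivot w, an independent set splits into vertices of two light levels,
    contributing sqrt |V| each, and heavy vertices, all active at the angle of w. *)
Lemma alpha_sweep_bag t :
  (alpha G (sweep_bag t))%:R <= (2 + C0%:R) * Num.sqrt #|V|%:R :> R.
Proof.
rewrite /alpha; elim/big_ind: _ => [|a b|S /andP[Sb indS]].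
- by rewrite mulr_ge0 ?sqrtr_ge0 // addr_ge0.
- by rewrite /maxn; case: ifP.
case: (set_0Vmem S) => [->|[v0 v0S]].
  by rewrite cards0 mulr_ge0 ?sqrtr_ge0 // addr_ge0.
have ind : {in S &, forall x y, ~~ G x y}.
  by move=> x y xS yS; move/forallP/(_ x): indS => /implyP/(_ xS)/forallP/(_ y)
    /implyP; apply.
have [w wP] := sweep_bag_pivot (fintype.subsetP Sb _ v0S).
pose L g := [set v | light (lay v) & nlight (lay v) == g]%SET.
pose H := [set v in S | ~~ light (lay v)]%SET.
have sub : S \subset (L (nlight (lay w)) :|: L (nlight (lay w)).-1 :|: H)%SET.
  apply/fintype.subsetP => x xS; rewrite !inE xS /=.
  case: (boolP (light (lay x))) => xl //=.
  have [y xy /light_in_bag h] := wP x (fintype.subsetP Sb _ xS).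
  by case: (h xy xl) => ->; rewrite eqxx ?orbT.
have Lq g : #|L g|%:R <= Num.sqrt #|V|%:R :> R.
  rewrite -(@ler_pXn2r _ 2) ?nnegrE ?sqrtr_ge0 // sqr_sqrtr ?ler0n //.
  by rewrite -natrX ler_nat card_light_level.
have Hq : #|H|%:R <= C0%:R * Num.sqrt #|V|%:R :> R.
  apply: (@card_heavy_in_bag H (theta w)) => [x y|x|x]; rewrite !inE.
  - by move=> /andP[xS _] /andP[yS _]; exact: ind.
  - by case/andP.
  - move=> /andP[xS xh]; have [y xy h] := wP x (fintype.subsetP Sb _ xS).
    by exists y => //; exact: heavy_in_bag h xh.
have : (#|S| <= #|L (nlight (lay w))| + #|L (nlight (lay w)).-1| + #|H|)%N.
  apply: leq_trans (subset_leq_card sub) _.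
  apply: leq_trans (leq_card_setU _ _) _; rewrite leq_add2r.
  exact: leq_card_setU.
rewrite -(@ler_nat R) !natrD => /le_trans; apply.
have := Lq (nlight (lay w)); have := Lq (nlight (lay w)).-1; lra.
Qed.

End LayeredSweep.

(** * Greedy layers *)

Section GreedyLayers.
Variables (R : realType) (V : finType) (phi : V -> R) (r : R).
Hypothesis r_ge0 : 0 <= r.

(* After i rounds the vertices v with 0 < L v <= i are in layers and those with
   L v = 0 are still free. *)
Record greedy (i : nat) (L : V -> nat) : Prop := Greedy {
  greedy_le : forall v, (L v <= i)%N;
  greedy_lt : forall u v, (0 < L u)%N -> (L v == 0%N) || (L u < L v)%N ->
    phi u < phi v;
  greedy_same : forall u v, (0 < L u)%N -> L u = L v -> phi u - phi v <= 2 * r;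
  greedy_gap : forall u v, (0 < L u)%N ->
    (L v == 0%N) && (L u < i)%N || ((L u).+1 < L v)%N -> 2 * r < phi v - phi u;
  greedy_free : forall v, L v = 0%N -> (i <= #|[set u | (0 < L u)%N]|)%N
}.

Lemma greedy0 : greedy 0 (fun _ => 0%N).
Proof. by split. Qed.

(** Here m is the least polar distance of a free vertex. Both conditions on m are vacuous when no
    vertex is free, so idle rounds are covered as well. *)
Lemma greedy_step i L m L' : greedy i L ->
  (forall v, L v = 0%N -> m <= phi v) ->
  (forall v, L v = 0%N -> exists2 u, L u = 0%N & phi u = m) ->
  (forall v, L' v = if (L v == 0%N) && (phi v <= m + r + r) then i.+1 else L v) ->
  greedy i.+1 L'.
Proof.
move=> [le lt same gap free] mle mex L'E.
have posL v : (0 < L' v)%N -> (0 < L v)%N \/ [/\ L v = 0%N, L' v = i.+1,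
    m <= phi v & phi v <= m + r + r].
  rewrite L'E; case: ifP => [/andP[/eqP v0 vm] _|]; last by left.
  by right; rewrite v0 mle.
have oldL v : (0 < L v)%N -> L' v = L v.
  by rewrite L'E lt0n => /negbTE ->.
have freeL v : L' v = 0%N -> L v = 0%N /\ m + r + r < phi v.
  rewrite L'E; case: ifP => // /negbT.
  by rewrite negb_and -ltNge => + v0; rewrite v0 eqxx.
split.
- by move=> v; rewrite L'E; case: ifP => // _; exact: leq_trans (le v) _.
- move=> u v /posL[u0|[u0 u1 mu um]] /orP[/eqP/freeL[v0 vm]|].
  + by apply: lt => //; rewrite v0.
  + rewrite oldL // => uv; case: (posnP (L v)) => v0; apply: lt => //.
      by rewrite v0.
    by rewrite -(oldL v) ?uv ?orbT.
  + exact: le_lt_trans um vm.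
  + by rewrite u1 L'E; case: ifP => _; [rewrite ltnn|have := le v; lia].
- move=> u v /posL[u0|[u0 u1 mu um]].
    rewrite oldL // => uv; case: (posnP (L v)) => v0.
      by move: uv; rewrite L'E v0 /=; case: ifP => _; have := le u; lia.
    by apply: same => //; rewrite uv oldL.
  rewrite u1 => uv; have [|vp|[v0 _ mv _]] := posL v; first by rewrite -uv.
    by have := le v; rewrite -oldL // -uv ltnn.
  by lra.
- move=> u v /posL[u0|[u0 u1 mu um]] /orP[/andP[/eqP/freeL[v0 vm] ui]|].
  (* The new layer separates u from v: its start m lies above u, and m + 2r lies below v. *)
  + have [w w0 wm] := mex v v0.
    have := lt u w u0; rewrite w0 => /(_ isT); lra.
  + rewrite oldL // => uv; case: (posnP (L v)) => v0; apply: gap => //.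
      move: uv; rewrite v0 eqxx L'E v0 /=.
      by case: ifP => // _; rewrite ltnS => ->.
    by rewrite -(oldL v) // uv orbT.
  + by move: ui; rewrite u1 ltnn.
  + by rewrite u1 L'E; case: ifP => _ uv; exfalso; [lia|have := le v; lia].
- move=> v /freeL[v0 vm]; have [w w0 wm] := mex v v0.
  apply: leq_ltn_trans (free v v0) _; apply: proper_card; apply/properP; split.
    by apply/fintype.subsetP => x; rewrite !inE => x0; rewrite oldL.
  exists w; rewrite !inE ?w0 // L'E w0 wm.
  by rewrite -addrA lerDl addr_ge0.
Qed.

(** A round that begins with a free vertex places at least one, so |V| rounds exhaust the
    vertices. *)
Lemma greedy_total L v : greedy #|V| L -> (0 < L v)%N.
Proof.
move=> g; rewrite lt0n; apply/eqP => v0; have := greedy_free g v0.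
rewrite leqNgt => /negP; apply; rewrite -cardsT; apply: proper_card.
apply/properP; split; first by apply/fintype.subsetP => u; rewrite !inE.
by exists v; rewrite !inE ?v0.
Qed.

Lemma greedy_near i L u v : greedy i L -> (0 < L v)%N -> `|phi u - phi v| <= 2 * r ->
  (L u <= (L v).+1)%N.
Proof.
move=> g v0; rewrite leqNgt => uv; apply/negP => h.
have := greedy_gap g v0 (v := u); rewrite h orbT => /(_ isT).
by rewrite ltNge (le_trans (ler_norm _)).
Qed.

End GreedyLayers.

(** * Loop programs *)

(** A fragment of the command language whose only loops run n times, so that a program denotes a
    total function on states and its running time can be bounded from its syntax. *)
Inductive prog :=
  | PSkip
  | PN (a : nat) (i j e : nexp)
  | PR (a : nat) (i j : nexp) (e : rexp)
  | PSeq (p1 p2 : prog)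
  | PIf (b : bexp) (p1 p2 : prog)
  | PFor (x : nat) (p : prog).

Notation cell x := (NGet x (NConst 0) (NConst 0)).

(* [PFor x p] runs [p] with cell (0, 0) of array [x] equal to 0, ..., n - 1. *)
Fixpoint compile (p : prog) : cmd :=
  match p with
  | PSkip => Skip
  | PN a i j e => NSet a i j e
  | PR a i j e => RSet a i j e
  | PSeq p1 p2 => Seq (compile p1) (compile p2)
  | PIf b p1 p2 => If b (compile p1) (compile p2)
  | PFor x p =>
      Seq (NSet x (NConst 0) (NConst 0) (NConst 0))
        (While (BNle (NAdd (cell x) (NConst 1)) NSize)
           (Seq (compile p)
              (NSet x (NConst 0) (NConst 0) (NAdd (cell x) (NConst 1)))))
  end.

Fixpoint nwrites (p : prog) : seq nat :=
  match p with
  | PN a _ _ _ => [:: a]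
  | PSeq p1 p2 | PIf _ p1 p2 => nwrites p1 ++ nwrites p2
  | PFor x p => x :: nwrites p
  | _ => [::]
  end.

Fixpoint rwrites (p : prog) : seq nat :=
  match p with
  | PR a _ _ _ => [:: a]
  | PSeq p1 p2 | PIf _ p1 p2 => rwrites p1 ++ rwrites p2
  | PFor x p => rwrites p
  | _ => [::]
  end.

(** No loop body may write its own counter; this makes a loop run exactly n rounds. *)
Fixpoint wf (p : prog) : bool :=
  match p with
  | PSeq p1 p2 | PIf _ p1 p2 => wf p1 && wf p2
  | PFor x p => (x \notin nwrites p) && wf p
  | _ => true
  end.

(** Both branches of a conditional are charged. A loop pays two units for its initialization and
    failing test, and two per round for test and increment. *)
Fixpoint cost (p : prog) : {poly nat} :=
  match p with
  | PSkip | PN _ _ _ _ | PR _ _ _ _ => 1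
  | PSeq p1 p2 => cost p1 + cost p2
  | PIf _ p1 p2 => 1 + (cost p1 + cost p2)
  | PFor x p => 2%:R + (cost p + 2%:R) * 'X
  end.

Section Semantics.
Variables (R : realType) (I : input R).
Local Notation n := (in_size I).
Implicit Types (s : state R) (p : prog).

Definition setn x k s : state R := State (update (nmem s) x 0 0 k) (rmem s).

Fixpoint den p s : state R :=
  match p with
  | PSkip => s
  | PN a i j e =>
      State (update (nmem s) a (neval I s i) (neval I s j) (neval I s e)) (rmem s)
  | PR a i j e =>
      State (nmem s) (update (rmem s) a (neval I s i) (neval I s j) (reval I s e))
  | PSeq p1 p2 => den p2 (den p1 s)
  | PIf b p1 p2 => if beval I s b then den p1 s else den p2 s
  | PFor x p => iteri n (fun k s => setn x k.+1 (den p s)) (setn x 0 s)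
  end.

Definition frame p s s' : Prop :=
  (forall a, a \notin nwrites p -> nmem s' a = nmem s a) /\
  (forall a, a \notin rwrites p -> rmem s' a = rmem s a).

Lemma update_neq (A : Type) (m : nat -> nat -> nat -> A) a i j x a' :
  a' != a -> update m a i j x a' = m a'.
Proof. by move=> /negbTE na; rewrite /update na. Qed.

Lemma den_frame p s : frame p s (den p s).
Proof.
elim: p s => [|a i j e|a i j e|p1 IH1 p2 IH2|b p1 IH1 p2 IH2|x p IH] s /=.
- by [].
- by split=> c //=; rewrite inE => ca; rewrite update_neq.
- by split=> c //=; rewrite inE => ca; rewrite update_neq.
- have [a1 b1] := IH1 s; have [a2 b2] := IH2 (den p1 s).
  by split=> c /=; rewrite mem_cat negb_or => /andP[c1 c2]; rewrite ?a2 ?a1 ?b2 ?b1.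
- have [a1 b1] := IH1 s; have [a2 b2] := IH2 s.
  by case: ifP => _; split=> c /=; rewrite mem_cat negb_or => /andP[c1 c2];
     rewrite ?a2 ?a1 ?b2 ?b1.
- elim: (in_size I) => [|k [a1 b1]] /=; split=> c /=.
  + by rewrite inE negb_or => /andP[cx _]; rewrite update_neq.
  + by [].
  + rewrite inE negb_or => /andP[cx cp]; rewrite update_neq // (IH _).1 // a1 //.
    by rewrite inE negb_or cx.
  + by move=> cp; rewrite (IH _).2 // b1.
Qed.

Lemma exec_compile p s : wf p ->
  exists2 t, exec I (compile p) s t (den p s) & (t <= (cost p).[n])%N.
Proof.
elim: p s => [|a i j e|a i j e|p1 IH1 p2 IH2|b p1 IH1 p2 IH2|x p IH] s /=.
- by exists 1%N; rewrite ?hornerE //; constructor.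
- by exists 1%N; rewrite ?hornerE //; constructor.
- by exists 1%N; rewrite ?hornerE //; constructor.
- move=> /andP[/(IH1 s)[t1 e1 l1] /(IH2 (den p1 s))[t2 e2 l2]].
  exists (t1 + t2)%N; first exact: ExecSeq e1 e2.
  by rewrite hornerD leq_add.
- move=> /andP[/(IH1 s)[t1 e1 l1] /(IH2 s)[t2 e2 l2]].
  rewrite !hornerD hornerC; case: ifPn => bs.
    by exists t1.+1; [exact: ExecIfTrue|rewrite -add1n leq_add2l (leq_trans l1) ?leq_addr].
  by exists t2.+1; [exact: ExecIfFalse|rewrite -add1n leq_add2l (leq_trans l2) ?leq_addl].
- move=> /andP[xp /IH {}IH].
  pose f k s' := setn x k.+1 (den p s').
  have xk k : nmem (iteri k f (setn x 0 s)) x 0%N 0%N = k.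
    by case: k => [|k] /=; rewrite /update !eqxx.
  (* Induction on the number d of rounds still to run after k rounds; the summand 1 pays for the
     failing test. *)
  have loop d k : (k + d = n)%N -> exists2 t,
      exec I (While (BNle (NAdd (cell x) (NConst 1)) NSize)
               (Seq (compile p)
                 (NSet x (NConst 0) (NConst 0) (NAdd (cell x) (NConst 1)))))
        (iteri k f (setn x 0 s)) t (iteri n f (setn x 0 s))
      & (t <= 1 + ((cost p).[n] + 2) * d)%N.
    elim: d k => [|d IHd] k kd.
      rewrite addn0 in kd; rewrite -kd; exists 1%N; last by rewrite muln0.
      by apply: ExecWhileFalse; rewrite /= xk -kd addn1 ltnn.
    have [t1 e1 l1] := IH (iteri k f (setn x 0 s)).
    have [|t2 e2 l2] := IHd k.+1; first by lia.
    exists (t1 + 1 + t2).+1; last by rewrite mulnS; lia.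
    apply: ExecWhileTrue e2; first by rewrite /= xk; lia.
    apply: ExecSeq e1 _.
    have -> : iteri k.+1 f (setn x 0 s) = setn x (neval I (den p (iteri k f (setn x 0 s)))
        (NAdd (cell x) (NConst 1))) (den p (iteri k f (setn x 0 s))).
      by rewrite /= (den_frame p _).1 // xk addn1.
    exact: ExecNSet.
  have [t e l] := loop n 0%N (add0n _).
  exists (1 + t)%N; first by apply: ExecSeq e; exact: ExecNSet.
  rewrite hornerD hornerMX hornerD -!polyCMn !hornerC.
  by apply: leq_trans (leq_add (leqnn 1) l) _; rewrite addnA.
Qed.

(** An invariant rule: each step is given the counter value and the frame relative to the state
    before the loop, so an invariant has to mention only the cells that change. *)
Lemma for_ind x p s (Inv : nat -> state R -> Prop) :
  x \notin nwrites p ->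
  Inv 0%N (setn x 0 s) ->
  (forall k s', (k < n)%N -> nmem s' x 0%N 0%N = k -> frame (PFor x p) s s' ->
     Inv k s' -> Inv k.+1 (setn x k.+1 (den p s'))) ->
  Inv n (den (PFor x p) s).
Proof.
move=> xp Inv0 step /=; set f := fun k _ => _.
have : (n <= n)%N by [].
suff : forall k, (k <= n)%N -> [/\ nmem (iteri k f (setn x 0 s)) x 0%N 0%N = k,
    frame (PFor x p) s (iteri k f (setn x 0 s)) & Inv k (iteri k f (setn x 0 s))].
  by move=> h /h[].
elim=> [|k IH] kn; split=> //=.
- by rewrite /update !eqxx.
- split=> a //=; rewrite inE negb_or => /andP[ax _]; exact: update_neq.
- by rewrite /update !eqxx.
- have [_ [fn fr] _] := IH (ltnW kn); split=> a /= na; last first.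
    by rewrite (den_frame p _).2 // fr.
  have := na; rewrite inE negb_or => /andP[ax ap].
  by rewrite update_neq // (den_frame p _).1 // fn.
- by have [xk fk Ik] := IH (ltnW kn); exact: step.
Qed.

End Semantics.

(** * The sweep program *)

Notation fld a x := (NGet a (cell x) (NConst 0)).
Notation zero := (NConst 0).
Notation one := (NConst 1).
Notation rcell a := (RGet a (NConst 0) (NConst 0)).
Notation two_pi := (RAdd RPi RPi).

(* Natural arrays: 0, 1, 2 output; 3 layers, counted from 1, with 0 for a free
   vertex; 4 ranks; 5 to 8 loop counters.  Real arrays: 0 least polar distance of
   a free vertex; 1 number of vertices; 2 size of the current layer; 3 next base
   value; 4 base values of the layers. *)
Definition count_vertices : prog :=
  PFor 6 (PR 1 zero zero (RAdd (rcell 1) ROne)).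

Definition find_min : prog :=
  PFor 6 (PIf (BAnd (BNle (fld 3 6) zero) (BRle (RPhi (cell 6)) (rcell 0)))
    (PR 0 zero zero (RPhi (cell 6))) PSkip).

Definition fill_layer : prog :=
  PFor 6 (PIf (BAnd (BNle (fld 3 6) zero)
                    (BRle (RPhi (cell 6)) (RAdd (RAdd (rcell 0) RRadius) RRadius)))
    (PSeq (PN 3 (cell 6) zero (NAdd (cell 5) one))
          (PR 2 zero zero (RAdd (rcell 2) ROne))) PSkip).

(** The base value of a layer is 2 pi times its [key]. A light layer takes the running value, which
    then grows by 4 pi; a heavy layer takes 2 pi more and leaves the running value alone. Counts are
    kept as reals because naturals cannot be multiplied. *)
Definition set_base : prog :=
  PIf (BRle (RMul (rcell 2) (rcell 2)) (rcell 1))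
    (PSeq (PR 4 (NAdd (cell 5) one) zero (rcell 3))
          (PR 3 zero zero (RAdd (rcell 3) (RAdd two_pi two_pi))))
    (PR 4 (NAdd (cell 5) one) zero (RAdd (rcell 3) two_pi)).

(** The search for the minimum starts at pi, an upper bound of all polar distances. A round without
    free vertices places nothing and gives a base value to an empty layer. *)
Definition round : prog :=
  PSeq (PR 0 zero zero RPi) (PSeq find_min
    (PSeq (PR 2 zero zero RZero) (PSeq fill_layer set_base))).

Definition sort_key x : rexp := RAdd (RGet 4 (fld 3 x) zero) (RTheta (cell x)).

Definition rank_vertex : prog :=
  PFor 7 (PIf (BRle (sort_key 6) (sort_key 7)) PSkip
    (PN 4 (cell 6) zero (NAdd (fld 4 6) one))).

Definition fill_bags_pair : prog :=
  PFor 8 (PIf (BAnd (BNle (fld 4 6) (cell 8)) (BNle (cell 8) (fld 4 7)))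
    (PN 2 (cell 8) (cell 6) one) PSkip).

Definition fill_bags_vertex : prog :=
  PFor 7 (PIf (BAnd (BNot (BAdj (cell 6) (cell 7)))
                    (BNot (BAnd (BNle (cell 6) (cell 7)) (BNle (cell 7) (cell 6)))))
    PSkip fill_bags_pair).

Definition draw_path : prog :=
  PFor 6 (PSeq (PN 1 (cell 6) (NAdd (cell 6) one) one)
               (PN 1 (NAdd (cell 6) one) (cell 6) one)).

(** The path gets n + 1 nodes, so that the tree is nonempty also for n = 0; the last bag is
    empty. *)
Definition sweep : prog :=
  PSeq count_vertices (PSeq (PFor 5 round) (PSeq (PFor 6 rank_vertex)
    (PSeq (PFor 6 fill_bags_vertex) (PSeq draw_path
      (PN 0 zero zero (NAdd NSize one)))))).

Lemma wf_sweep : wf sweep. Proof. by []. Qed.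

(** * Effect of each phase of the program on the arrays *)

Section Specifications.
Variables (R : realType) (I : input R).
Local Notation n := (in_size I).
Local Notation phi := (in_phi I).
Local Notation theta := (in_theta I).
Local Notation r := (in_radius I).
Implicit Types s : state R.
Local Notation den := (den I).
Local Notation lab s v := (nmem s 3 v 0%N).
Local Notation rnk s v := (nmem s 4 v 0%N).

Lemma count_vertices_spec s :
  rmem (den count_vertices s) 1 0 0 = rmem s 1 0 0 + n%:R.
Proof.
apply: (@for_ind _ _ 6%N _ s (fun k s' => rmem s' 1 0 0 = rmem s 1 0 0 + k%:R)) => //.
  by rewrite addr0.
by move=> k s' _ _ _ /= e; rewrite /update /= e -addrA natr1.
Qed.

Lemma find_min_spec s : let s' := den find_min s in
  (forall v, (v < n)%N -> lab s v = 0%N -> rmem s' 0 0 0 <= phi v) /\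
  (rmem s' 0 0 0 = rmem s 0 0 0 \/
   exists v, [/\ (v < n)%N, lab s v = 0%N & phi v = rmem s' 0 0 0]).
Proof.
apply: (@for_ind _ _ 6%N _ s (fun k s' =>
  (forall v, (v < k)%N -> lab s v = 0%N -> rmem s' 0 0 0 <= phi v) /\
  (rmem s' 0 0 0 = rmem s 0 0 0 \/
   exists v, [/\ (v < n)%N, lab s v = 0%N & phi v = rmem s' 0 0 0]))) => //.
  by split=> //; left.
move=> k s' kn xk [fn _] [le ex] /=; rewrite xk fn // leqn0.
case: ifPn => [/andP[/eqP v0 vm]|nv] /=.
  rewrite /update /=; split; last by right; exists k.
  move=> v; rewrite ltnS leq_eqVlt => /orP[/eqP -> //|vk vl].
  exact: le_trans (le v vk vl).
split=> // v; rewrite ltnS leq_eqVlt => /orP[/eqP -> vl|]; last exact: le.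
by move: nv; rewrite vl /= -ltNge => /ltW.
Qed.

Definition taken s v := (lab s v == 0%N) && (phi v <= rmem s 0 0 0 + r + r).

Lemma fill_layer_spec s : let s' := den fill_layer s in
  (forall v, (v < n)%N ->
     lab s' v = if taken s v then (nmem s 5 0 0).+1 else lab s v) /\
  rmem s' 2 0 0 = rmem s 2 0 0 + (\sum_(v < n) taken s v)%:R.
Proof.
suff : let s' := den fill_layer s in
  (forall v, lab s' v = if (v < n)%N && taken s v then (nmem s 5 0 0).+1
                        else lab s v) /\
  rmem s' 2 0 0 = rmem s 2 0 0 + (\sum_(v < n) taken s v)%:R.
  by move=> /= [h1 h2]; split=> // v vn; rewrite h1 vn.
apply: (@for_ind _ _ 6%N _ s (fun k s' =>
  (forall v, lab s' v = if (v < k)%N && taken s v then (nmem s 5 0 0).+1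
                        else lab s v) /\
  rmem s' 2 0 0 = rmem s 2 0 0 + (\sum_(v < k) taken s v)%:R)) => //.
  by split=> //; rewrite big_ord0 addr0.
move=> k s' kn xk [fn fr] [le ex] /=; rewrite xk le ltnn /= fr // leqn0.
rewrite -[_ && _]/(taken s k) big_ord_recr /=; case: ifPn => tk /=.
  rewrite /update /= ex natrD addrA; split=> // v.
  rewrite eqxx andbT ltnS leq_eqVlt le fn // addn1.
  by case: eqP => [->|] //=; rewrite tk.
rewrite addn0 ex; split=> // v; rewrite /update /= ltnS leq_eqVlt le.
by case: eqP => [->|] //=; rewrite ltnn (negbTE tk).
Qed.

Lemma set_base_spec s (b := (rmem s 2 0 0) ^+ 2 <= rmem s 1 0 0) :
  let s' := den set_base s in
  rmem s' 3 0 0 = rmem s 3 0 0 + 2 * pi * (2 * b)%:R /\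
  (forall l, rmem s' 4 l 0 = if l == (nmem s 5 0 0).+1
     then rmem s 3 0 0 + 2 * pi * (~~ b)%:R else rmem s 4 l 0).
Proof.
rewrite /= -expr2 -/b addn1; case: ifP => _ /=; rewrite /update /=.
  split=> [|l]; first by ring.
  by rewrite mulr0 addr0 andbT.
split=> [|l]; first by ring.
rewrite andbT; case: eqP => // _; ring.
Qed.

Lemma round_spec s (s' := den round s) :
  (forall v, (v < n)%N -> phi v <= pi) -> rmem s 1 0 0 = n%:R ->
  exists m, [/\
    (forall v, (v < n)%N -> lab s v = 0%N -> m <= phi v),
    (forall v, (v < n)%N -> lab s v = 0%N ->
       exists u, [/\ (u < n)%N, lab s u = 0%N & phi u = m]),
    (forall v, (v < n)%N -> lab s' v =
       if (lab s v == 0%N) && (phi v <= m + r + r) then (nmem s 5 0 0).+1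
       else lab s v) &
    let b := ((\sum_(v < n) ((lab s v == 0%N) && (phi v <= m + r + r)%R)) ^ 2 <= n)%N in
    rmem s' 3 0 0 = rmem s 3 0 0 + 2 * pi * (2 * b)%:R /\
    (forall l, rmem s' 4 l 0 = if l == (nmem s 5 0 0).+1
       then rmem s 3 0 0 + 2 * pi * (~~ b)%:R else rmem s 4 l 0)].
Proof.
move=> phi_pi sn; pose s1 := den (PR 0 zero zero RPi) s.
pose s2 := den find_min s1; pose s3 := den (PR 2 zero zero RZero) s2.
pose s4 := den fill_layer s3.
have [min1 min2] := find_min_spec s1; rewrite -/s2 in min1 min2.
have [n2 r2] := den_frame I find_min s1; rewrite -/s2 in n2 r2.
have [n4 r4] := den_frame I fill_layer s3; rewrite -/s4 in n4 r4.
have [lab4 sz4] := fill_layer_spec s3; rewrite -/s4 in lab4 sz4.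
have [b3 b4] := set_base_spec s4.
have [n5 r5] := den_frame I set_base s4.
rewrite -/s' in b3 b4 n5 r5.
have nm2 a : a != 6 -> nmem s2 a = nmem s a by move=> a6; rewrite n2 ?inE.
have rm3 a : a != 0%N -> a != 2 -> rmem s3 a = rmem s a.
  by move=> a0 a2; rewrite /s3 /= update_neq // r2 ?inE // /s1 /= update_neq.
have tk v : taken s3 v = (lab s v == 0%N) && (phi v <= rmem s2 0 0 0 + r + r).
  by rewrite /taken /s3 /= nm2.
exists (rmem s2 0 0 0); split => //.
(* If the search kept its initial value pi, then phi v <= pi forces v itself to attain it. *)
- move=> v vn v0; case: min2 => [e|[u [un u0 um]]]; last by exists u.
  have pi1 : rmem s1 0 0 0 = pi by [].
  exists v; split=> //; apply/eqP.
  by rewrite eq_le (min1 v vn v0) andbT e pi1 phi_pi.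
- move=> v vn; rewrite n5 // lab4 // tk.
  by rewrite /s3 /= nm2 // nm2.
- have e4 : nmem s4 5 0 0 = nmem s 5 0 0 by rewrite n4 // /s3 /= nm2.
  have z4 : rmem s4 2 0 0 ^+ 2 <= rmem s4 1 0 0 =
    ((\sum_(v < n) ((lab s v == 0%N) && (phi v <= rmem s2 0 0 0 + r + r)%R)) ^ 2 <= n)%N.
    rewrite sz4 r4 // (rm3 1%N) // sn /s3 /= {1}/update /= add0r -natrX ler_nat.
    by congr (_ ^ 2 <= _)%N; apply: eq_bigr => v _; rewrite tk.
  move: b3 b4; rewrite z4 e4 r4 // rm3 // => -> b4; split=> // l.
  by rewrite b4 r4 // rm3.
Qed.

Definition nkey s v : R := rmem s 4 (lab s v) 0 + theta v.

Lemma rank_vertex_spec s v : nmem s 6 0 0 = v ->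
  forall w, rnk (den rank_vertex s) w =
    if w == v then (rnk s v + \sum_(u < n) (nkey s u < nkey s v)%R)%N else rnk s w.
Proof.
move=> sv; apply: (@for_ind _ _ 7%N _ s (fun k s' => forall w, rnk s' w =
    if w == v then (rnk s v + \sum_(u < k) (nkey s u < nkey s v)%R)%N
    else rnk s w)) => //.
  by move=> w; rewrite big_ord0 addn0; case: eqP => [->|].
move=> k s' kn xk [fn fr] IH w /=; rewrite xk (fn 6%N) // (fn 3%N) // sv !fr //.
rewrite -/(nkey s v) -/(nkey s k) big_ord_recr /= ltNge; case: ifP => _ /=.
  by rewrite addn0; exact: IH.
rewrite /update /=; case: (eqVneq w v) => [->|wv] /=.
  by rewrite IH eqxx addnA.
by rewrite IH (negbTE wv).
Qed.

Lemma rank_spec s (s' := den (PFor 6 rank_vertex) s) : (forall v, rnk s v = 0%N) ->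
  forall v, (v < n)%N -> rnk s' v = (\sum_(u < n) (nkey s u < nkey s v)%R)%N.
Proof.
move=> s0; suff : forall v, rnk s' v =
    if (v < n)%N then (\sum_(u < n) (nkey s u < nkey s v)%R)%N else 0%N.
  by move=> h v vn; rewrite h vn.
apply: (@for_ind _ _ 6%N _ s (fun k s' => forall v, rnk s' v =
    if (v < k)%N then (\sum_(u < n) (nkey s u < nkey s v)%R)%N else 0%N)) => //.
move=> k t kn xk [fn fr] IH v.
have nk u : nkey t u = nkey s u by rewrite /nkey fn // fr.
rewrite [nmem _]/= update_neq // (rank_vertex_spec xk) !IH ltnS
  (leq_eqVlt v k) ltnn add0n.
case: (eqVneq v k) => [->|] //=; by under eq_bigr do rewrite !nk.
Qed.

Lemma fill_bags_pair_spec s v u : nmem s 6 0 0 = v -> nmem s 7 0 0 = u ->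
  forall t w, (nmem (den fill_bags_pair s) 2 t w != 0%N) =
    (nmem s 2 t w != 0%N) || [&& w == v, (t < n)%N & (rnk s v <= t <= rnk s u)%N].
Proof.
move=> sv su; apply: (@for_ind _ _ 8%N _ s (fun k s' => forall t w,
  (nmem s' 2 t w != 0%N) = (nmem s 2 t w != 0%N) ||
   [&& w == v, (t < k)%N & (rnk s v <= t <= rnk s u)%N])) => //.
  by move=> t w; rewrite /= andbF orbF.
move=> k s' kn xk [fn _] IH t w /=; rewrite xk (fn 4%N) // (fn 6%N) // (fn 7%N) //.
rewrite sv su ltnS (leq_eqVlt t k).
case: ifPn => h /=.
  rewrite /update /=; case: (eqVneq t k) => [->|tk] /=; last exact: IH.
  by case: (eqVneq w v) => [->|wv] /=; rewrite ?h ?orbT // IH (negbTE wv).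
rewrite IH; case: (eqVneq t k) => [->|tk] //=.
by rewrite ltnn /= (negbTE h).
Qed.

Definition closed_adj v u := (v == u) || in_adj I v u.

Lemma has_iotaS (P : pred nat) k : has P (iota 0 k.+1) = has P (iota 0 k) || P k.
Proof. by rewrite -addn1 iotaD has_cat /= add0n orbF. Qed.

Lemma fill_bags_vertex_spec s v : nmem s 6 0 0 = v ->
  forall t w, (nmem (den fill_bags_vertex s) 2 t w != 0%N) =
    (nmem s 2 t w != 0%N) || [&& w == v, (t < n)%N, (rnk s v <= t)%N &
      has (fun u => closed_adj v u && (t <= rnk s u)%N) (iota 0 n)].
Proof.
move=> sv; apply: (@for_ind _ _ 7%N _ s (fun k s' => forall t w,
  (nmem s' 2 t w != 0%N) =
    (nmem s 2 t w != 0%N) || [&& w == v, (t < n)%N, (rnk s v <= t)%N &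
      has (fun u => closed_adj v u && (t <= rnk s u)%N) (iota 0 k)])) => //.
  by move=> t w; rewrite /= !andbF orbF.
move=> k s' kn xk [fn _] IH t w; rewrite has_iotaS.
have s'v : nmem s' 6 0 0 = v by rewrite fn.
rewrite [nmem _]/= update_neq // s'v xk -eqn_leq -negb_or orbC -/(closed_adj v k).
case: (closed_adj v k) => /=; last by rewrite orbF IH.
rewrite (fill_bags_pair_spec s'v xk) IH !(fn 4%N) //.
by case: (_ != _); case: (_ == _); case: (t < n)%N; case: (_ <= t)%N => //=.
Qed.

Lemma fill_bags_spec s (s' := den (PFor 6 fill_bags_vertex) s) :
  (forall t v, nmem s 2 t v = 0%N) ->
  forall t v, (v < n)%N -> (nmem s' 2 t v != 0%N) =
    [&& (t < n)%N, (rnk s v <= t)%N &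
      has (fun u => closed_adj v u && (t <= rnk s u)%N) (iota 0 n)].
Proof.
move=> s0; suff : forall t v, (nmem s' 2 t v != 0%N) =
    [&& (v < n)%N, (t < n)%N, (rnk s v <= t)%N &
      has (fun u => closed_adj v u && (t <= rnk s u)%N) (iota 0 n)].
  by move=> h t v vn; rewrite h vn.
apply: (@for_ind _ _ 6%N _ s (fun k s' => forall t v, (nmem s' 2 t v != 0%N) =
    [&& (v < k)%N, (t < n)%N, (rnk s v <= t)%N &
      has (fun u => closed_adj v u && (t <= rnk s u)%N) (iota 0 n)])) => //.
  by move=> t v; apply/negbTE; rewrite negbK; apply/eqP; exact: s0.
move=> k s1 kn xk [fn _] IH t v.
rewrite [nmem _]/= update_neq // (fill_bags_vertex_spec xk) IH ltnS
  (leq_eqVlt v k) (fn 4%N) //.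
by case: (eqVneq v k) => [->|] /=; rewrite ?ltnn ?orbF.
Qed.

Lemma draw_path_spec s : (forall i j, nmem s 1 i j = 0%N) ->
  forall i j, (i <= n)%N -> (j <= n)%N -> (nmem (den draw_path s) 1 i j != 0%N) =
    (i.+1 == j) || (j.+1 == i).
Proof.
move=> s0; suff h : forall i j, (nmem (den draw_path s) 1 i j != 0%N) =
    (i.+1 == j) && (i < n)%N || (j.+1 == i) && (j < n)%N.
  by move=> i j i_n j_n; rewrite h; lia.
apply: (@for_ind _ _ 6%N _ s (fun k s' => forall i j, (nmem s' 1 i j != 0%N) =
    (i.+1 == j) && (i < k)%N || (j.+1 == i) && (j < k)%N)) => //.
  move=> i j; rewrite !andbF; apply/negbTE; rewrite negbK; apply/eqP.
  exact: s0.
move=> k s' kn xk _ IH i j /=; rewrite xk addn1 /update /= xk addn1.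
case: ifP => [h|h1]; first by lia.
case: ifP => [h|h2]; first by lia.
by rewrite IH; lia.
Qed.

End Specifications.

(** * Sweeping a disk graph *)

Section GreedyExists.
Variables (R : realType) (V : finType) (phi : V -> R) (r : R).
Hypothesis r_ge0 : 0 <= r.

Lemma greedy_exists i : exists L, greedy phi r i L.
Proof.
elim: i => [|i [L gL]]; first by exists (fun _ => 0%N); exact: greedy0.
have [m mle mex] : exists2 m, forall v, L v = 0%N -> m <= phi v &
    forall v, L v = 0%N -> exists2 u, L u = 0%N & phi u = m.
  case: (pickP (fun v => L v == 0%N)) => [v0 v00|none]; last first.
    by exists 0 => v /eqP; rewrite none.
  case: (@arg_minP _ _ _ v0 (fun v => L v == 0%N) phi v00) => w /eqP w0 wmin.
  exists (phi w) => v /eqP v0'; first exact: wmin.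
  by exists w.
by exists (fun v => if (L v == 0%N) && (phi v <= m + r + r) then i.+1 else L v);
   exact: greedy_step gL mle mex _.
Qed.

End GreedyExists.

(** Two light layers per bag, and per heavy layer two meridians with 29^3 cells each. *)
Definition sweep_constant : nat := 2 + 2 * 29 ^ 3.

Section DiskSweep.
Variables (R : realType) (F : polar_system R) (V : finType) (r : R).
Variables (c : V -> 'rV[R]_3) (G : rel V) (phi theta : V -> R) (L : V -> nat).
Hypothesis r_itv : 0 < r < pi.
Hypothesis G_sym : symmetric G.
Hypothesis Gc : disk_realization r c G.
Hypothesis polar : forall x, polar_coordinates F (c x) (phi x) (theta x).
Hypothesis gL : greedy phi r #|V| L.
Local Notation lay := (fun v => (L v).-1).

(** Stated for an arbitrary greedy labelling and any sufficiently long path, to serve both the bound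
    on the tree-independence number and the output of the program. Labels start at 1 and layers at
    0, hence the predecessor. *)
Lemma disk_sweep m (E : rel 'I_m) (bag : 'I_m -> {set V}) :
  (0 < m)%N -> (#|V| <= m)%N ->
  (forall i j, E i j = (i.+1 == j) || (j.+1 == i)) ->
  (forall t, bag t = sweep_bag G lay theta t) ->
  tree_decomposition G E bag /\
  (decomposition_alpha G bag)%:R <= sweep_constant%:R * Num.sqrt #|V|%:R :> R.
Proof.
move=> m0 Vm Epath bagE.
have r0 : 0 <= r by case/andP: r_itv => /ltW.
split.
  apply: (@path_decomposition m E Epath V G (krank lay theta)) => //.
    by move=> v; exact: leq_trans (krank_lt _ _ v) Vm.
  by move=> t v; rewrite bagE inE.
rewrite /decomposition_alpha; elim/big_ind: _ => [|a b|t _].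
- by rewrite mulr_ge0 ?sqrtr_ge0.
- by rewrite /maxn; case: ifP.
rewrite bagE /sweep_constant natrD; apply: alpha_sweep_bag => //.
- exact: theta_itv polar.
- move=> u v /(disk_adjacent r_itv Gc polar)[uv _].
  have := greedy_near gL (greedy_total v gL) uv.
  by have := greedy_total u gL; have := greedy_total v gL; lia.
move=> S omega l ind Sl; apply: (layer_slice r_itv Gc polar ind) => x y xS yS.
have xy : L x = L y.
  have := Sl x xS; have := Sl y yS.
  by have := greedy_total x gL; have := greedy_total y gL; lia.
have x0 := greedy_total x gL; have y0 := greedy_total y gL.
rewrite ler_norml; have := greedy_same gL x0 xy.
have := greedy_same gL y0 (esym xy) => h1 h2.
by apply/andP; split; lra.
Qed.

End DiskSweep.

(** * Existence of polar coordinates and the bound on the tree-independence number *)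

Section PolarExists.
Variable R : realType.

Lemma dot_delta (i : 'I_3) (u : 'rV[R]_3) : dot (delta_mx ord0 i) u = u ord0 i.
Proof.
rewrite /dot (bigD1 i) //= mxE !eqxx mul1r big1 ?addr0 // => j ji.
by rewrite mxE eqxx (negbTE ji) mul0r.
Qed.

Lemma standard_polar_system : exists F : polar_system R,
  [/\ po F = delta_mx ord0 (inord 0), pa F = delta_mx ord0 (inord 1)
    & pb F = delta_mx ord0 (inord 2)].
Proof.
have d (i j : 'I_3) : dot (delta_mx ord0 i) (delta_mx ord0 j) = (i == j)%:R :> R.
  by rewrite dot_delta mxE eqxx.
have e (k l : nat) : (k < 3)%N -> (l < 3)%N -> k != l ->
    (inord k == inord l :> 'I_3) = false.
  by move=> k3 l3 /negbTE kl; apply/eqP => /(congr1 val); rewrite /= !inordK // => /eqP; rewrite kl.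
have h1 : [/\ sphere (delta_mx ord0 (inord 0) : 'rV[R]_3),
  sphere (delta_mx ord0 (inord 1) : 'rV[R]_3)
  & sphere (delta_mx ord0 (inord 2) : 'rV[R]_3)].
  by split; rewrite /sphere /= d eqxx.
have h2 : [/\ dot (delta_mx ord0 (inord 0) : 'rV[R]_3) (delta_mx ord0 (inord 1)) = 0,
  dot (delta_mx ord0 (inord 0) : 'rV[R]_3) (delta_mx ord0 (inord 2)) = 0
  & dot (delta_mx ord0 (inord 1) : 'rV[R]_3) (delta_mx ord0 (inord 2)) = 0].
  by split; rewrite d e.
by exists (PolarSystem h1 h2).
Qed.

Lemma angle_exists (x y : R) : x ^+ 2 + y ^+ 2 = 1 ->
  exists t, [/\ 0 <= t < 2 * pi, cos t = x & sin t = y].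
Proof.
move=> xy.
have x1 : -1 <= x <= 1.
  rewrite -ler_norml -(@ler_pXn2r _ 2) ?nnegrE // real_normK ?num_real // expr1n.
  by have := sqr_ge0 y; lra.
have sx : Num.sqrt (1 - x ^+ 2) = `|y|.
  by rewrite -sqrtr_sqr; congr Num.sqrt; lra.
have p0 := @pi_gt0 R; have a0 := acos_ge0 x1; have ap := acos_lepi x1.
have cx : cos (acos x) = x by rewrite acosK // in_itv.
case: (leP 0 y) => y0.
  exists (acos x); split => //; first by rewrite a0 /=; lra.
  by rewrite sin_acos // sx ger0_norm.
(* For y < 0 the angle is 2 pi - acos x; excluding x = 1 keeps it below 2 pi. *)
have xl : x < 1.
  case/andP: x1 => _; rewrite le_eqVlt => /orP[/eqP x1|//]; exfalso.
  by move: xy; rewrite x1; nra.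
have agt : 0 < acos x by rewrite acos_gt0 // xl andbT; case/andP: x1.
exists (- acos x + pi *+ 2); split.
- by apply/andP; rewrite mulr2n; split; lra.
- by rewrite cosD2pi cosN.
- by rewrite sinD2pi sinN sin_acos // sx ltr0_norm // opprK.
Qed.

Lemma polar_exists (F : polar_system R) (p : 'rV[R]_3) :
  po F = delta_mx ord0 (inord 0) -> pa F = delta_mx ord0 (inord 1) ->
  pb F = delta_mx ord0 (inord 2) -> sphere p ->
  exists a t, polar_coordinates F p a t.
Proof.
move=> Fo Fa Fb p1.
have o1 : sphere (po F) by case: F {Fo Fa Fb} => ? ? ? [].
set a := sdist (po F) p.
have ca : cos a = p ord0 (inord 0) by rewrite cos_sdist // Fo dot_delta.
have sa : 0 <= sin a by rewrite sin_ge0_pi ?sdist_itv.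
have i0 : @inord 2 0 = ord0 :> 'I_3 by apply/val_inj; rewrite /= inordK.
have i1 : @inord 2 1 = lift ord0 ord0 :> 'I_3 by apply/val_inj; rewrite /= inordK.
have i2 : @inord 2 2 = lift ord0 (lift ord0 ord0) :> 'I_3
  by apply/val_inj; rewrite /= inordK.
have sum1 : p ord0 (inord 1) ^+ 2 + p ord0 (inord 2) ^+ 2 = sin a ^+ 2.
  move: (p1 : dot p p = 1); rewrite sin2cos2 ca /dot !big_ord_recl big_ord0.
  by rewrite -i2 -i1 -i0; lra.
have [t [t_itv ct st]] : exists t, [/\ 0 <= t < 2 * pi,
    sin a * cos t = p ord0 (inord 1) & sin a * sin t = p ord0 (inord 2)].
  (* At the poles every angle is valid, and 0 is chosen. *)
  case: (eqVneq (sin a) 0) => [s0|sn0].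
    move: sum1; rewrite s0 expr0n => /eqP.
    rewrite paddr_eq0 ?sqr_ge0 // !sqrf_eq0 => /andP[/eqP -> /eqP ->].
    by exists 0; rewrite !mul0r lexx mulr_gt0 ?pi_gt0.
  have [|t [t_itv ct st]] :=
      @angle_exists (p ord0 (inord 1) / sin a) (p ord0 (inord 2) / sin a).
    by rewrite !expr_div_n -mulrDl sum1 divff // expf_neq0.
  by exists t; rewrite ct st !(mulrC (sin a)) !divfK.
exists a, t; split => //; rewrite Fo Fa Fb scalerDr !scalerA ct st ca.
apply/matrixP => i j; rewrite ord1 !mxE /= i0 i1 i2.
by case: (unliftP ord0 j) => [k ->|->]; [case: (unliftP ord0 k) => [l ->|->]|];
   rewrite ?[l]ord1 /= ?mulr0 ?mulr1 ?addr0 ?add0r.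
Qed.

(** A realization provides only centers; polar coordinates are chosen in the standard frame, and the
    decomposition comes from an abstract greedy labelling. *)
Lemma disk_graph_tree_alpha (r : R) (V : finType) (G : rel V) :
  0 < r < pi -> simple_graph G -> spherical_uniform_disk_graph r G ->
  (tree_independence_number G)%:R <= sweep_constant%:R * Num.sqrt #|V|%:R :> R.
Proof.
move=> r_itv [G_sym _] [c Gc].
have [F [Fo Fa Fb]] := standard_polar_system.
have /choice[pt polar] : forall x, exists pt : R * R,
    polar_coordinates F (c x) pt.1 pt.2.
  move=> x; have [a [t h]] := polar_exists Fo Fa Fb (Gc.1 x).
  by exists (a, t).
have r0 : 0 <= r by case/andP: r_itv => /ltW.
have [L gL] := greedy_exists (fun x => (pt x).1) r0 #|V|.
pose E (i j : 'I_#|V|.+1) := (i.+1 == j) || (j.+1 == i).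
pose bag (t : 'I_#|V|.+1) :=
  sweep_bag G (fun v => (L v).-1) (fun x => (pt x).2) t.
have [dec] := @disk_sweep R F V r c G _ _ L r_itv G_sym Gc polar gL
  #|V|.+1 E bag isT (leqnSn _) (fun _ _ => erefl) (fun _ => erefl).
apply: le_trans; rewrite ler_nat /tree_independence_number.
case: ex_minnP => k _; apply; apply/asboolP.
by exists 'I_#|V|.+1, E, bag.
Qed.

End PolarExists.

(** * Correctness of the sweep program *)

Section SweepCorrect.
Variables (R : realType) (I : input R).
Local Notation n := (in_size I).
Local Notation phi := (in_phi I).
Local Notation r := (in_radius I).
Implicit Types s : state R.
Local Notation den := (den I).
Local Notation labels s := (fun v : 'I_n => nmem s 3 v 0%N).
Hypothesis r_ge0 : 0 <= r.
Hypothesis phi_pi : forall v, (v < n)%N -> phi v <= pi.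

Definition size_layer s l : nat := \sum_(v < n) (nmem s 3 v 0 == l.+1).
Definition light_layer s l : bool := (size_layer s l ^ 2 <= n)%N.
Definition light_below s l : nat := \sum_(j < l) light_layer s j.

(** The last two clauses say that the stored base values are 2 pi times the keys of the layers, with
    array 4 indexed by labels, which start at 1. *)
Definition layers_inv i s : Prop :=
  [/\ greedy (fun v : 'I_n => phi v) r i (labels s),
    rmem s 1 0 0 = n%:R,
    rmem s 3 0 0 = 2 * pi * (2 * light_below s i)%:R &
    forall l, (l < i)%N -> rmem s 4 l.+1 0 =
      2 * pi * ((light_below s l).*2 + ~~ light_layer s l)%:R].

Lemma layers_spec s : (forall v, nmem s 3 v 0 = 0%N) -> rmem s 1 0 0 = n%:R ->
  rmem s 3 0 0 = 0 -> layers_inv n (den (PFor 5 round) s).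
Proof.
move=> s3 sn sb; apply: (@for_ind _ _ 5%N _ s layers_inv) => //.
  split=> //; last by rewrite /light_below big_ord0 muln0 mulr0.
  have -> : labels (setn 5 0 s) = (fun _ => 0%N) by apply/funext => v; exact: s3.
  exact: greedy0.
move=> i s' i_n s'i _ [gL s'n s'b s'H].
have [m [mle mex labE [bE HE]]] := round_spec phi_pi s'n.
have [_ /(_ 1%N isT) r1] := den_frame I round s'.
set s1 := den round s' in labE bE HE r1 *.
rewrite s'i in labE HE.
(* A round only turns labels 0 into i + 1, so the earlier layers are final and keep their sizes and
   weights. *)
have sizeE l : (l < i)%N -> size_layer s1 l = size_layer s' l.
  move=> li; apply: eq_bigr => v _; rewrite labE //.
  by case: ifP => // /andP[/eqP -> _]; congr nat_of_bool; lia.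
have sizei : size_layer s1 i =
    (\sum_(v < n) ((nmem s' 3 v 0 == 0%N) && (phi v <= m + r + r)%R))%N.
  apply: eq_bigr => v _; rewrite labE //; case: ifP => h; first by rewrite eqxx.
  by rewrite ltn_eqF // ltnS (greedy_le gL v).
have lightE l : (l < i)%N -> light_layer s1 l = light_layer s' l.
  by move=> li; rewrite /light_layer sizeE.
have belowE l : (l <= i)%N -> light_below s1 l = light_below s' l.
  by move=> li; apply: eq_bigr => j _; rewrite lightE // (leq_trans _ li).
have belowS : light_below s1 i.+1 = (light_below s' i + light_layer s1 i)%N.
  by rewrite /light_below big_ord_recr /= -/(light_below s1 i) belowE.
rewrite -sizei -/(light_layer s1 i) in bE HE.
suff : layers_inv i.+1 s1 by [].
split.
- apply: (greedy_step r_ge0 gL (m := m)) => [v|v /(mex v (ltn_ord v))[u [un u0 um]]|v].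
  + exact: mle.
  + by exists (Ordinal un).
  + exact: labE.
- by rewrite r1.
- by rewrite bE s'b belowS -mulrDr -natrD -mulnDr.
- move=> l; rewrite ltnS leq_eqVlt HE eqSS; case: (eqVneq l i) => [-> _|_ /= li].
    by rewrite s'b -mulrDr -natrD belowE // mul2n.
  by rewrite s'H // belowE ?lightE // ltnW.
Qed.

End SweepCorrect.

(** The arrays are identified phase by phase with the abstract order: labels with greedy layers,
    base value plus theta with [kappa], counts with [krank], and the incidence matrix with
    [sweep_bag]. *)
Lemma sweep_spec (R : realType) (n : nat) (G : rel 'I_n) (r : R)
    (F : polar_system R) (c : 'I_n -> 'rV[R]_3) (phi theta : 'I_n -> R)
    (I := realization_input G r F c phi theta) (s := den I sweep (initial_state R)) :
  0 <= r -> (forall v, phi v <= pi) ->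
  out_size s = n.+1 /\ exists2 L, greedy phi r #|'I_n| L &
    (forall i j : 'I_(out_size s), out_edge i j = (i.+1 == j) || (j.+1 == i)) /\
    (forall t : 'I_(out_size s),
       out_bag n t = sweep_bag G (fun v => (L v).-1) theta t).
Proof.
move=> r0 phi_pi.
have phiE v : in_phi I (val v) = phi v by rewrite /= /extend valK.
have thetaE v : in_theta I (val v) = theta v by rewrite /= /extend valK.
have adjE u v : closed_adj I (val u) (val v) = (u == v) || G u v.
  by rewrite /closed_adj /= /extend !valK.
pose s1 := den I count_vertices (initial_state R).
pose s2 := den I (PFor 5 round) s1.
pose s3 := den I (PFor 6 rank_vertex) s2.
pose s4 := den I (PFor 6 fill_bags_vertex) s3.
pose s5 := den I draw_path s4.
have [n1 r1] := den_frame I count_vertices (initial_state R).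
have [n2 r2] := den_frame I (PFor 5 round) s1.
have [n3 r3] := den_frame I (PFor 6 rank_vertex) s2.
have [n4 r4] := den_frame I (PFor 6 fill_bags_vertex) s3.
have [n5 r5] := den_frame I draw_path s4.
rewrite -/s1 -/s2 -/s3 -/s4 -/s5 in n1 r1 n2 r2 n3 r3 n4 r4 n5 r5.
have sE : s = den I (PN 0 zero zero (NAdd NSize one)) s5 by [].
have [gL _ _ HE] : layers_inv I n s2.
  apply: layers_spec => [//|v vn|v||].
  - by rewrite -[v]/(val (Ordinal vn)) phiE.
  - by rewrite n1.
  - by rewrite /s1 count_vertices_spec add0r.
  - by rewrite r1.
pose L v := nmem s2 3 (val (v : 'I_n)) 0.
have {}gL : greedy phi r n L.
  have -> : phi = (fun v : 'I_n => in_phi I v) by apply/funext => v; rewrite phiE.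
  exact: gL.
rewrite -[n in greedy _ _ n]card_ord in gL.
have out : out_size s = n.+1 by rewrite sE /out_size /= /update /= addn1.
pose lay v := (L v).-1.
have layerE l : #|layer lay l| = size_layer I s2 l.
  rewrite /size_layer -sum1_card big_mkcond; apply: eq_bigr => v _.
  have L0 := greedy_total v gL; rewrite inE /lay -[nmem _ _ _ _]/(L v).
  by rewrite -[in RHS](prednK L0) eqSS; case: eqP.
have lightE l : light lay l = light_layer I s2 l.
  by rewrite /light layerE card_ord.
have keyE (v : 'I_n) : nkey I s2 v = kappa lay theta v.
  have := greedy_total v gL; have := greedy_le gL v; rewrite card_ord => Ln L0.
  rewrite /nkey -/(L v) -(prednK L0) HE; last by rewrite prednK.
  rewrite /kappa thetaE /key lightE; congr (_ * (_.*2 + _)%:R + _).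
  by apply: eq_bigr => j _; rewrite lightE.
have rankE (v : 'I_n) : nmem s4 4 v 0 = krank lay theta v.
  rewrite n4 // rank_spec // /krank; last by move=> w; rewrite n2 // n1.
  rewrite -sum1_card [RHS]big_mkcond; apply: eq_bigr => u _.
  by rewrite inE !keyE; case: (kappa _ _ _ < _).
split=> //; exists L => //; split=> [i j|t].
  have ij (k : 'I_(out_size s)) : (k <= n)%N by rewrite -ltnS -out.
  rewrite /out_edge -[nmem s 1]/(nmem s5 1) draw_path_spec //.
  by move=> u v; rewrite n4 // n3 // n2 // n1.
apply/setP => v; rewrite !inE -[nmem s 2]/(nmem s5 2) n5 //.
rewrite fill_bags_spec //; last by move=> u w; rewrite n3 // n2 // n1.
have rank3 (u : 'I_n) : nmem s3 4 u 0 = krank lay theta u by rewrite -rankE n4.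
rewrite rank3; apply/and3P/andP => [[tn rt /hasP[u]]|[rt /existsP[u /andP[uv tu]]]].
  rewrite mem_iota add0n => /= un /andP[uv tu]; split=> //; apply/existsP.
  by exists (Ordinal un); rewrite -adjE uv -rank3.
split=> //.
  (* The program fills only rows t < n; membership in an abstract bag forces this, since t is at
     most some rank and ranks are below n. *)
  by apply: leq_ltn_trans tu _; apply: leq_trans (krank_lt _ _ u) _; rewrite card_ord.
apply/hasP; exists (val u); first by rewrite mem_iota add0n ltn_ord.
by rewrite adjE uv rank3.
Qed.

Theorem corollary3p16 (R : realType) :
  exists C : R,
    (forall (r : R) (V : finType) (G : rel V),
        0 < r < pi -> simple_graph G -> spherical_uniform_disk_graph r G ->
        (tree_independence_number G)%:R <= C * Num.sqrt #|V|%:R) /\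
    (exists (P : cmd) (q : {poly nat}),
      forall (r : R) (n : nat) (G : rel 'I_n) (F : polar_system R)
             (c : 'I_n -> 'rV[R]_3) (phi theta : 'I_n -> R),
        0 < r < pi -> simple_graph G -> disk_realization r c G ->
        (forall u, polar_coordinates F (c u) (phi u) (theta u)) ->
        exists (t : nat) (s : state R),
          [/\ exec (realization_input G r F c phi theta) P (initial_state R) t s,
              (t <= q.[n])%N,
              tree_decomposition G (@out_edge R s) (@out_bag R n s)
            & (decomposition_alpha G (@out_bag R n s))%:R
                <= C * Num.sqrt n%:R]).
Proof.
exists sweep_constant%:R; split; first exact: disk_graph_tree_alpha.
exists (compile sweep), (cost sweep) => r n G F c phi theta r_itv [G_sym _] Gc polar.
have [t run time] :=
  exec_compile (realization_input G r F c phi theta) (initial_state R) wf_sweep.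
have r0 : 0 <= r by case/andP: r_itv => /ltW.
have phi_pi v : phi v <= pi by case/andP: (phi_itv Gc polar v).
have [out [L gL [edgeE bagE]]] := sweep_spec G F c theta r0 phi_pi.
have [||dec al] := disk_sweep r_itv G_sym Gc polar gL _ _ edgeE bagE.
- by rewrite out.
- by rewrite out card_ord.
by rewrite card_ord in al; exists t; eexists; split; [exact: run|exact: time| |].
Qed.
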